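(* Let $K$ be a field and let $\Delta$ be a simplicial complex on the vertex set $[n]$ with $\dim \Delta \ge 2$. Then the following conditions are equivalent: (i) $I_\Delta^{(m)}$ is generalized Cohen-Macaulay for every $m \ge 1$. (ii) $I_\Delta^{(m)}$ is generalized Cohen-Macaulay for some $m \ge 3$. (iii) $\Delta$ is a union of disjoint matroids of the same dimension.
   Context: $K$ is an arbitrary field, $[n]=\{1,\dots,n\}$, $S=K[x_1,\dots,x_n]$, $\mathfrak m=(x_1,\dots,x_n)$. A simplicial complex $\Delta$ on $[n]$ is a family of subsets (faces) of $[n]$ closed under taking subsets and containing every $\{i\}$, $i\in[n]$; $\dim\Delta=\max\{|F|-1: F\in\Delta\}$; $\mathcal F(\Delta)$ is the set of facets (maximal faces). The Stanley-Reisner ideal is $I_\Delta=(x_{i_1}\cdots x_{i_p} : 1\le i_1<\dots<i_p\le n,\ \{i_1,\dots,i_p\}\notin\Delta)\subset S$. For $F\subseteq[n]$ put $P_F=(x_i: i\in F)$ and $\overline F=[n]\setminus F$. Then $I_\Delta=\bigcap_{F\in\mathcal F(\Delta)}P_{\overline F}$, and for $m\ge1$ the $m$-th symbolic power is $I_\Delta^{(m)}=\bigcap_{F\in\mathcal F(\Delta)}P_{\overline F}^{\,m}$. A homogeneous ideal $I\subset S$ is generalized Cohen-Macaulay if $\dim_K H^i_{\mathfrak m}(S/I)<\infty$ for $i=0,1,\dots,\dim S/I-1$. A simplicial complex is a matroid if for all faces $F,G$ with $|F|>|G|$ there is $i\in F\setminus G$ such that $G\cup\{i\}$ is a face. A union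 of disjoint complexes means a union of complexes on pairwise disjoint vertex sets. *)

(* Defs.v *)
From HB Require Import structures.
From mathcomp Require Import all_boot all_order all_algebra.
From mathcomp Require Import mpoly.
Set Implicit Arguments.
Unset Strict Implicit.
Unset Printing Implicit Defensive.
Import Order.TTheory GRing.Theory Num.Theory.
Local Open Scope ring_scope.

Section SimplicialComplexes.

Variable n : nat.
Implicit Types (V F G : {set 'I_n}) (D : {set {set 'I_n}}).

(* The vertex set [n] = {1, ..., n} is represented by 'I_n = {0, ..., n-1}. *)
Definition simplicial_complex V D : Prop :=
  [/\ forall F, F \in D -> F \subset V,
      forall F G, F \in D -> G \subset F -> G \in D
    & forall i, i \in V -> [set i] \in D].

Definition dim_complex D : int := (\max_(F in D) #|F|)%:Z - 1.

Definition facets D : {set {set 'I_n}} :=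
  [set F | maxset (fun G => G \in D) F].

Definition matroid D : Prop :=
  forall F G, F \in D -> G \in D -> (#|G| < #|F|)%N ->
    exists2 i, i \in F :\: G & i |: G \in D.

Definition disjoint_union_of_matroids D : Prop :=
  exists (k : nat) (V : 'I_k -> {set 'I_n}) (M : 'I_k -> {set {set 'I_n}}),
    [/\ forall j, simplicial_complex (V j) (M j) /\ matroid (M j),
        forall j l, j != l -> [disjoint V j & V l],
        forall j l, dim_complex (M j) = dim_complex (M l)
      & D = \bigcup_j M j].

End SimplicialComplexes.

Section Ideals.

Variable R : comNzRingType.

Definition ideal_gen (G : R -> Prop) (f : R) : Prop :=
  exists s : seq (R * R),
    (forall p, p \in s -> G p.2) /\ f = \sum_(p <- s) p.1 * p.2.

Definition ideal_power (I : R -> Prop) (m : nat) : R -> Prop :=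
  ideal_gen (fun g => exists t : 'I_m -> R,
    (forall j, I (t j)) /\ g = \prod_(j < m) t j).

(* i < dim R/I: there is a chain P_0 < ... < P_(i+1) of prime ideals of R
   containing I. In the library, idealr_closed includes 1 \notin P. *)
Definition lt_krull_dim (i : nat) (I : R -> Prop) : Prop :=
  exists P : nat -> {pred R},
    (forall j, (j <= i.+1)%N ->
       [/\ idealr_closed (P j), prime_idealr_closed (P j)
         & forall f, I f -> f \in P j]) /\
    (forall j, (j < i.+1)%N ->
       {subset P j <= P j.+1} /\ exists2 f, f \in P j.+1 & f \notin P j).

End Ideals.

Section LocalCohomology.

Variables (K : fieldType) (n : nat).

Local Notation S := {mpoly K[n]}.
Local Notation Q := {fraction S}.
Local Notation "f %:F" := (FracField.tofrac f).

Implicit Types (F : {set 'I_n}) (I : S -> Prop).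

Definition monom_of_set F : S := \prod_(i in F) 'X_i.

(* The submodule I S_(x_F) of the localization S_(x_F), inside Frac S;
   S_(x_F) itself is the case where I is the unit ideal. *)
Definition localized I F (q : Q) : Prop :=
  exists (f : S) (k : nat), I f /\ q = f%:F / (monom_of_set F ^+ k)%:F.

Definition unit_ideal : S -> Prop := fun=> True.

(* H^i_m(S/I) is the i-th cohomology of the Cech complex of S/I with respect
   to x_1, ..., x_n, whose term in degree p is the direct sum over |F| = p of
   (S/I)_(x_F) = S_(x_F) / I S_(x_F). A cochain of degree p is represented by
   a function c on subsets, of which only the values c F in S_(x_F) for
   |F| = p matter, and each of these only modulo I S_(x_F). *)
Definition cech_diff (c : {set 'I_n} -> Q) F : Q :=
  \sum_(i in F) (-1) ^+ #|[set j in F | (j < i)%N]| * c (F :\ i).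

Definition cech_cochain (p : nat) (c : {set 'I_n} -> Q) : Prop :=
  forall F, #|F| = p -> localized unit_ideal F (c F).

Definition cech_cocycle I (p : nat) (c : {set 'I_n} -> Q) : Prop :=
  cech_cochain p c /\
  forall F, #|F| = p.+1 -> localized I F (cech_diff c F).

(* For p = 0 the only relevant F is set0, where cech_diff b vanishes, so that
   0 is the only coboundary of degree 0 modulo I. *)
Definition cech_coboundary I (p : nat) (c : {set 'I_n} -> Q) : Prop :=
  exists b : {set 'I_n} -> Q,
    (forall q, q.+1 = p -> cech_cochain q b) /\
    forall F, #|F| = p -> localized I F (c F - cech_diff b F).

(* dim_K H^p_m(S/I) < oo: finitely many classes of cocycles span over K. *)
Definition fin_dim_local_cohomology I (p : nat) : Prop :=
  exists (N : nat) (e : 'I_N -> {set 'I_n} -> Q),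
    (forall j, cech_cocycle I p (e j)) /\
    forall c, cech_cocycle I p c ->
      exists a : 'I_N -> K,
        cech_coboundary I p
          (fun F => c F - \sum_(j < N) ((a j)%:MP_[n])%:F * e j F).

Definition generalized_Cohen_Macaulay I : Prop :=
  forall i, lt_krull_dim i I -> fin_dim_local_cohomology I i.

End LocalCohomology.

Section SymbolicPowers.

Variables (K : fieldType) (n : nat).

Definition var_ideal (F : {set 'I_n}) : {mpoly K[n]} -> Prop :=
  ideal_gen (fun g => exists2 i, i \in F & g = 'X_i).

(* I_D^(m), where I_D is the intersection of the primes P_(~: F), F a facet. *)
Definition symbolic_power (D : {set {set 'I_n}}) (m : nat)
    (f : {mpoly K[n]}) : Prop :=
  forall F, F \in facets D -> ideal_power (var_ideal (~: F)) m f.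

End SymbolicPowers.

(* Main.v *)
(** The degree-a part of the Cech complex of S/I^(m), for a in Z^n, is the
    cochain complex of the family of faces F with G <= F <= H for some facet H
    with a(~: H) < m, where G = {i | a_i < 0} and only the positive part of a
    counts in a(~: H) (Takayama's formula). If some a_i >= m, this family is a
    cone; if G is nonempty, replacing a_i by a_i - 1 for i in G changes nothing.
    Hence I^(m) is generalized Cohen-Macaulay if and only if for all a with G
    nonempty the family is acyclic below degree dim D + 1.

    For a matroid, the bases H containing G with a(H) >= t generate an acyclic
    family: split off a vertex v of least weight; by basis exchange, deleting or
    contracting v gives a family of the same kind, unless v is in every such H,
    and then the family is a cone.

    Conversely, vanishing for a = 0 makes D pure and the links of nonempty faces
    connected, and the weights (1, m - 2, m - 1) make links of dimension 1
    matroids; here m >= 3 is used. A connected complex of dimension at least 2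
    all of whose vertex links are matroids is a matroid, so by induction all
    links of nonempty faces, and finally the connected components of D, are
    matroids. *)

Require Import Defs.
From mathcomp Require Import all_boot all_order all_algebra.
From mathcomp Require Import mpoly.
From mathcomp Require Import zify.
Set Implicit Arguments.
Unset Strict Implicit.
Unset Printing Implicit Defensive.
Import Order.TTheory GRing.Theory Num.Theory.
Local Open Scope ring_scope.

(** * Cohomology of families of sets *)

Section Cohomology.

Variables (R : comNzRingType) (n : nat).
Implicit Types (i j v : 'I_n) (F G H U : {set 'I_n}) (L : {set {set 'I_n}}).
Implicit Types (c b : {set 'I_n} -> R).

Definition inc_sign i F : R := (-1) ^+ #|[set j in F | (j < i)%N]|.

Definition coboundary c F : R := \sum_(i in F) inc_sign i F * c (F :\ i).

Definition supported L c := forall F, F \notin L -> c F = 0.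

(** Exactness in degree [p] of the cochain complex on [L], the degree of a set being its
    cardinality. Cochains are total functions vanishing off [L], and [coboundary] is only read on
    members of [L]. *)
Definition acyclic L (p : nat) := forall c, supported L c ->
  (forall F, F \in L -> #|F| = p.+1 -> coboundary c F = 0) ->
  exists2 b, supported L b & forall F, F \in L -> #|F| = p -> c F = coboundary b F.

(** This makes the coboundary cut down to [L] square to zero: no intermediate [F :\ i] is lost
    between [F] and [F :\ i :\ j]. *)
Definition convex L := forall F1 F F2,
  F1 \in L -> F2 \in L -> F1 \subset F -> F \subset F2 -> F \in L.

Lemma inc_sign_sqr i F : inc_sign i F * inc_sign i F = 1.
Proof. by rewrite -expr2 sqrr_sign. Qed.

Lemma inc_sign_swap i j F : i \in F -> j \in F -> i != j ->
  inc_sign i F * inc_sign j (F :\ i) = - (inc_sign j F * inc_sign i (F :\ j)).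
Proof.
wlog ltij : i j / (i < j)%N => [hw iF jF neq|iF jF neq].
  case: (ltngtP i j) => h.
  - exact: hw.
  - by rewrite (hw j i) ?opprK // eq_sym.
  - by rewrite (val_inj h) eqxx in neq.
have -> : inc_sign i (F :\ j) = inc_sign i F.
  congr (_ ^+ _); apply: eq_card => k; rewrite !inE.
  by case: (k =P j) => [->|//] /=; rewrite [(j < i)%N]ltnNge ltnW //= andbF.
have -> : inc_sign j F = - inc_sign j (F :\ i).
  rewrite /inc_sign (cardsD1 i [set k in F | (k < j)%N]) inE iF ltij /= exprS mulN1r.
  by congr (- (_ ^+ _)); apply: eq_card => k; rewrite !inE andbA.
by rewrite mulNr opprK mulrC.
Qed.

Lemma eq_coboundary c b F :
  (forall i, i \in F -> c (F :\ i) = b (F :\ i)) -> coboundary c F = coboundary b F.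
Proof. by move=> h; apply: eq_bigr => i iF; rewrite h. Qed.

Lemma coboundaryD c b F :
  coboundary (fun F => c F + b F) F = coboundary c F + coboundary b F.
Proof. by rewrite -big_split /=; apply: eq_bigr => i _; rewrite mulrDr. Qed.

Lemma coboundaryB c b F :
  coboundary (fun F => c F - b F) F = coboundary c F - coboundary b F.
Proof. by rewrite -sumrB /=; apply: eq_bigr => i _; rewrite mulrBr. Qed.

Lemma coboundaryZ a c F : coboundary (fun F => a * c F) F = a * coboundary c F.
Proof. by rewrite mulr_sumr; apply: eq_bigr => i _; rewrite mulrCA. Qed.

Lemma coboundary0 c F : (forall i, i \in F -> c (F :\ i) = 0) -> coboundary c F = 0.
Proof. by move=> h; rewrite /coboundary big1 // => i iF; rewrite h ?mulr0. Qed.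

Lemma coboundaryK c F : coboundary (coboundary c) F = 0.
Proof.
pose t i j := inc_sign i F * inc_sign j (F :\ i) * c (F :\ i :\ j).
have -> : coboundary (coboundary c) F =
    \sum_(i in F) \sum_(j in F | j != i) t i j.
  apply: eq_bigr => i iF; rewrite mulr_sumr; apply: eq_big => [j|j _].
    by rewrite !inE andbC.
  by rewrite mulrA.
have half : \sum_(i in F) \sum_(j in F | j != i) t i j =
    \sum_(i in F) \sum_(j in F | (j < i)%N) t i j +
    \sum_(i in F) \sum_(j in F | (i < j)%N) t i j.
  rewrite -big_split; apply: eq_bigr => i iF /=.
  rewrite (bigID (fun j => (j < i)%N)) /=; congr (_ + _); apply: eq_bigl => j.
    by rewrite -andbA; congr (_ && _); rewrite -val_eqE neq_ltn /=; case: (j < i)%N; rewrite ?andbF.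
  by rewrite -andbA; congr (_ && _); rewrite -val_eqE neq_ltn /= -leqNgt; case: ltngtP.
rewrite half [X in _ + X](exchange_big_dep (fun j => j \in F)) /=; last by move=> i j _ /andP[].
rewrite -big_split big1 //= => i iF.
under [X in _ + X]eq_bigl do rewrite iF /=.
rewrite -big_split big1 //= => j /andP[jF ji].
rewrite /t inc_sign_swap //; last by rewrite -val_eqE neq_ltn ji orbT.
by rewrite mulNr addrC !setDDl setUC subrr.
Qed.

(** Long exact sequence: cochains on the members containing [v] form a subcomplex, those on the
    members avoiding [v] the quotient. A primitive on the quotient is subtracted first; what remains
    lives on sets through [v]. *)
Lemma acyclic_split L v p : convex L ->
  acyclic [set F in L | v \in F] p -> acyclic [set F in L | v \notin F] p ->
  acyclic L p.
Proof.
move=> cL acA acB c cs cd.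
pose cB F := if v \in F then 0 else c F.
have [|F /[!inE] /andP[FL vF] Fp|bB bBs cBE] := acB cB.
- by move=> F; rewrite inE /cB; case: (v \in F) => //=; rewrite andbT => /cs.
- rewrite -[RHS](cd F FL Fp); apply: eq_coboundary => i _.
  by rewrite /cB inE (negPf vF) andbF.
(* Cutting the corrected cocycle to 0 off [L] leaves its coboundary on [L] unchanged, by
   convexity. *)
pose c' F := if F \in L then c F - coboundary bB F else 0.
have c'd F : F \in L -> #|F| = p.+1 -> coboundary c' F = 0.
  move=> FL Fp; rewrite -[RHS](cd F FL Fp) -[RHS]subr0 -(coboundaryK bB F) -coboundaryB.
  apply: eq_coboundary => i iF; rewrite /c'; case: ifPn => // niL.
  rewrite (cs _ niL) sub0r; apply/esym/eqP; rewrite oppr_eq0; apply/eqP.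
  apply: coboundary0 => j jF; apply: bBs; apply: contraNN niL => /[!inE] /andP[jL _].
  by apply: cL jL FL _ _; rewrite subD1set.
have c'B F : F \in L -> v \notin F -> #|F| = p -> c' F = 0.
  move=> FL vF Fp; rewrite /c' FL -cBE ?inE ?FL //.
  by rewrite /cB (negPf vF) subrr.
pose cA F := if v \in F then c' F else 0.
have [|F /[!inE] /andP[FL vF] Fp|bA bAs cAE] := acA cA.
- move=> F; rewrite inE /cA; case: (v \in F) => //=; rewrite andbT => nF.
  by rewrite /c' (negPf nF).
- rewrite -[RHS](c'd F FL Fp); apply: eq_coboundary => i iF.
  rewrite /cA; case: ifPn => // nv.
  case: (boolP (F :\ i \in L)) => [iL|niL]; last by rewrite /c' (negPf niL).
  by rewrite c'B //; move: Fp; rewrite (cardsD1 i F) iF add1n => -[].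
exists (fun F => bA F + bB F) => [F FL|F FL Fp].
  by rewrite bAs ?bBs ?addr0 // inE (negPf FL).
rewrite coboundaryD; case: (boolP (v \in F)) => vF.
  by rewrite -cAE ?inE ?FL // /cA vF /c' FL subrK.
rewrite -cBE ?inE ?FL // /cB (negPf vF) coboundary0 ?add0r // => i iF.
by apply: bAs; rewrite !inE (negPf vF) !andbF.
Qed.

(** The contracting homotopy inserts [v]: at a set [F] avoiding [v] the primitive is [c (v |: F)] up
    to sign. *)
Lemma acyclic_cone L v p : (forall F, F \in L -> v |: F \in L) ->
  (forall F, F \in L -> F :\ v \in L) -> acyclic L p.
Proof.
move=> addv remv c cs cd.
exists (fun F => if v \in F then 0 else inc_sign v F * c (v |: F)) => [F FL|F FL Fp].
  case: ifP => // vF; rewrite cs ?mulr0 //.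
  by apply: contraNN FL => /remv; rewrite setU1K ?vF.
have sD E : inc_sign v (E :\ v) = inc_sign v E.
  congr (_ ^+ _); apply: eq_card => k; rewrite !inE.
  by case: (k =P v) => //= ->; rewrite ltnn andbF.
case: (boolP (v \in F)) => vF.
  rewrite /coboundary (bigD1 v) //= setD11 setD1K // big1 ?addr0.
    by rewrite sD mulrA inc_sign_sqr mul1r.
  by move=> i /andP[iF iv]; rewrite !inE vF eq_sym iv /= mulr0.
(* For [F] avoiding [v], the cocycle identity at [v |: F] expresses [c F] through values at sets
   containing [v]. *)
set E := v |: F; have vE : v \in E by rewrite setU11.
have := cd E (addv _ FL); rewrite cardsU1 vF Fp => /(_ erefl).
rewrite /coboundary (bigD1 v) //= setU1K // => /eqP; rewrite addr_eq0 => /eqP eqE.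
rewrite -[LHS]mul1r -(inc_sign_sqr v E) -mulrA eqE -sumrN mulr_sumr.
apply: eq_big => [i|i /andP[iE iv]]; first by rewrite !inE; case: eqP => [->|_]; rewrite ?(negPf vF) ?andbT.
have iF : i \in F by move: iE; rewrite !inE (negPf iv).
rewrite !inE (negPf vF) andbF mulrA.
have -> : v |: F :\ i = E :\ i by apply/setP => k; rewrite !inE; case: (k =P v) => // ->; rewrite eq_sym iv.
rewrite mulrN mulrA -mulNr; congr (_ * _).
rewrite -(setU1K vF) -/E.
have -> : inc_sign v (E :\ v :\ i) = inc_sign v (E :\ i) by rewrite setDDl setUC -setDDl sD.
have := inc_sign_swap vE iE; rewrite eq_sym => /(_ iv) sw.
have h : inc_sign i (E :\ v) = - (inc_sign v E * inc_sign i E * inc_sign v (E :\ i)).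
  by rewrite -mulrA -mulrN -sw mulrA inc_sign_sqr mul1r.
by rewrite h mulNr -[X in _ = - X]mulrA inc_sign_sqr mulr1.
Qed.

End Cohomology.

(** * Matroids *)

Section MatroidAcyclic.

Variables (R : comNzRingType) (n : nat).
Implicit Types (i j v : 'I_n) (F G H U : {set 'I_n}) (D L : {set {set 'I_n}}).

(** [G] collects the elements contracted so far and [U] those not yet deleted, while [r] stays the
    size of the bases throughout. *)
Definition heavy_interval D (r : nat) (w : 'I_n -> nat) (t : nat) G U :=
  [set F : {set 'I_n} | (G \subset F) &&
    [exists H in D, [&& F \subset H, H \subset U, #|H| == r
                      & (t <= \sum_(i in H) w i)%N]]].

Lemma heavy_intervalP D r w t G U F :
  reflect (G \subset F /\ exists H, [/\ H \in D, F \subset H, H \subset U, #|H| = r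
                      & (t <= \sum_(i in H) w i)%N])
    (F \in heavy_interval D r w t G U).
Proof.
rewrite inE; apply: (iffP andP) => [[GF /existsP[H /and5P[]]]|[GF [H [HD FH HU Hr Ht]]]].
  by move=> HD FH HU /eqP Hr Ht; split=> //; exists H.
by split=> //; apply/existsP; exists H; rewrite HD FH HU Hr eqxx.
Qed.

Lemma heavy_interval_convex D r w t G U : convex (heavy_interval D r w t G U).
Proof.
move=> F1 F F2 /heavy_intervalP[GF _] /heavy_intervalP[_ [H [HD FH HU Hr Ht]]] F1F FF2.
by apply/heavy_intervalP; split; [apply: subset_trans F1F|exists H; split => //; apply: subset_trans FH].
Qed.

(* The link of [v] keeps the shape [heavy_interval], and if [v] has minimal
   weight outside [G], so does the deletion of [v]: basis exchange replaces [v]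
   by an element of no smaller weight. *)
Lemma heavy_interval_acyclic D r w t G U p :
  (forall F H, F \in D -> H \subset F -> H \in D) -> matroid D ->
  G \subset U -> (p < r)%N -> acyclic R (heavy_interval D r w t G U) p.
Proof.
move=> Dsub Dmat GU pr; move: {2}#|U :\: G| (erefl #|U :\: G|) => k.
elim: k G U GU => [|k IH] G U GU UG.
  have {UG} UG : U = G.
    apply/eqP; rewrite eqEsubset GU andbT -setD_eq0.
    by rewrite -cards_eq0 UG.
  (* Each member contains [G = U], hence a face of size [r > p], so no member has size [p]. *)
  move=> c cs _; exists (fun=> 0) => // F /heavy_intervalP[GF [H [_ FH HU Hr _]]] Fp.
  have : (r <= p)%N by rewrite -Hr -Fp; apply: subset_leq_card; rewrite (subset_trans HU) ?UG.
  by rewrite leqNgt pr.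
have [v0 v0U] : exists v, v \in U :\: G by apply/set0Pn; rewrite -cards_eq0 UG.
case: (arg_minnP w v0U) => v vU vmin {v0 v0U}.
have {}vU : v \in U :\: G by []. have /setDP[vU' vG] := vU.
have cardGv : #|U :\: (v |: G)| = k.
  by move: UG; rewrite (cardsD1 v) vU setDDl setUC => -[].
have cardUv : #|(U :\ v) :\: G| = k by rewrite setDDl.
(* The weight threshold is left out of this test: any face [H0] of size [r] avoiding [v] supplies
   the exchange partner of [v]. *)
case: (boolP [exists H in D, [&& G \subset H, H \subset U :\ v & #|H| == r]]) => [|noH].
  case/existsP => H0 /and4P[H0D GH0 H0U /eqP H0r].
  apply: (@acyclic_split _ _ _ v); first exact: heavy_interval_convex.
    have -> : [set F in heavy_interval D r w t G U | v \in F] =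
              heavy_interval D r w t (v |: G) U.
      by apply/setP => F; rewrite !inE subUset sub1set -andbA [RHS]andbAC andbA andbC -!andbA; do !bool_congr.
    by apply: IH; rewrite ?subUset ?sub1set ?vU'.
  have -> : [set F in heavy_interval D r w t G U | v \notin F] =
            heavy_interval D r w t G (U :\ v).
    apply/setP => F; rewrite inE; apply/andP/heavy_intervalP; last first.
      case=> GF [H [HD FH HU Hr Ht]]; split; last first.
        by apply/negP => /(subsetP FH) /(subsetP HU); rewrite !inE eqxx.
      by apply/heavy_intervalP; split=> //; exists H; split=> //; apply: subset_trans HU (subsetDl _ _).
    case=> /heavy_intervalP[GF [H [HD FH HU Hr Ht]]] vF; split=> //.
    case: (boolP (v \in H)) => vH; last by exists H; split => //; rewrite subsetD1 HU.
    have FH' : F \subset H :\ v by rewrite subsetD1 FH.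
    have cH' : (#|H :\ v| < #|H0|)%N by rewrite H0r -Hr [in leqRHS](cardsD1 v) vH.
    have [u] := Dmat H0 (H :\ v) H0D (Dsub _ _ HD (subsetDl _ _)) cH'.
    rewrite !inE negb_and negbK => /andP[uH uH0] uD.
    have uv : u != v by apply: contraTneq uH0 => ->; apply/negP => /(subsetP H0U); rewrite !inE eqxx.
    rewrite (negPf uv) /= in uH.
    have uU : u \in U by have := subsetP H0U _ uH0; rewrite !inE => /andP[].
    have uG : u \notin G by apply: contraNN uH => /(subsetP GF) /(subsetP FH).
    exists (u |: (H :\ v)); split => //.
    - by apply: subset_trans FH' (subsetUr _ _).
    - by rewrite subUset sub1set !inE uv uU setSD.
    - by rewrite cardsU1 !inE (negPf uH) andbF -Hr [in RHS](cardsD1 v) vH.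
    - apply: leq_trans Ht _; rewrite (big_setD1 v) //= big_setU1 ?inE ?(negPf uH) ?andbF //=.
      by rewrite leq_add2r; apply: vmin; apply/setDP.
  by apply: IH => //; rewrite subsetD1 GU.
apply: (@acyclic_cone _ _ _ v) => F /heavy_intervalP[GF [H [HD FH HU Hr Ht]]].
  have vH : v \in H.
    apply: contraNT noH => vH; apply/existsP; exists H.
    by rewrite HD (subset_trans GF FH) subsetD1 HU vH Hr /=.
  apply/heavy_intervalP; split; first by apply: subset_trans GF (subsetUr _ _).
  by exists H; split=> //; rewrite subUset sub1set vH.
apply/heavy_intervalP; split; first by rewrite subsetD1 GF.
by exists H; split=> //; apply: subset_trans FH; apply: subsetDl.
Qed.

End MatroidAcyclic.

(** * From acyclicity to matroids *)

Section LowDegrees.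

Variables (R : comNzRingType) (n : nat).
Implicit Types (i j v x y : 'I_n) (F G H U C : {set 'I_n}) (D L : {set {set 'I_n}}).

Lemma coboundary_setU1 (b : {set 'I_n} -> R) y G :
  (forall F, ~~ (G \subset F) -> b F = 0) -> y \notin G ->
  coboundary b (y |: G) = inc_sign R y (y |: G) * b G.
Proof.
move=> b0 yG; rewrite /coboundary (bigD1 y) ?setU11 //= setU1K // big1 ?addr0 //.
move=> i /andP[/setU1P[->|iG]]; first by rewrite eqxx.
by move=> iy; rewrite b0 ?mulr0 //; apply/negP => /subsetP/(_ _ iG); rewrite !inE eqxx.
Qed.

(** The sets [x |: G] act as vertices, those with one more element as edges. The coboundary of the
    indicator of [G], cut down to the vertices in [C], is a cocycle because no edge leaves [C]; a
    primitive acts through its value at [G] alone, hence treats all vertices alike. *)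
Lemma acyclic_connected L G C :
  (forall F, F \in L -> G \subset F) ->
  (forall F F', F \in L -> G \subset F' -> F' \subset F -> F' \in L) ->
  acyclic R L #|G|.+1 ->
  (forall v x, v \in C -> v \notin G -> x \notin G -> v |: (x |: G) \in L -> x \in C) ->
  forall v x, v \in C -> v \notin G -> v |: G \in L ->
    x \notin G -> x |: G \in L -> x \in C.
Proof.
move=> GL sL acL cC v x vC vG vL xG xL; apply/negPn/negP => xC.
pose one_G F : R := (F == G)%:R.
have one_G0 F : ~~ (G \subset F) -> one_G F = 0.
  by rewrite /one_G; case: eqP => // ->; rewrite subxx.
pose c F := if [&& F \in L, #|F| == #|G|.+1 & ~~ [disjoint F :\: G & C]]
            then coboundary one_G F else 0.
have [|F FL Fp|b bs bE] := acL c.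
- by move=> F FL; rewrite /c (negPf FL).
- case: (boolP [disjoint F :\: G & C]) => [dFC|].
    apply: coboundary0 => i iF; rewrite /c.
    by rewrite (disjointWl _ dFC) ?andbF //; apply/setSD/subsetDl.
  case/pred0Pn => y /andP[/setDP[yF yG] yC].
  have FC : F :\: G \subset C.
    apply/subsetP => z /setDP[zF zG]; apply: (cC y) => //.
    apply: (sL F) => //; last by rewrite !subUset !sub1set yF zF GL.
    by rewrite (subset_trans (subsetUr [set z] G)) // subsetUr.
  rewrite -[RHS](coboundaryK one_G F); apply: eq_coboundary => i iF; rewrite /c.
  case: (boolP (i \in G)) => iG.
    have nG : ~~ (G \subset F :\ i) by apply/negP => /subsetP/(_ _ iG); rewrite !inE eqxx.
    rewrite ifN; last by apply/negP => /andP[/GL]; rewrite (negPf nG).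
    rewrite coboundary0 // => j _; apply: one_G0; apply: contraNN nG => /subset_trans; apply.
    exact: subsetDl.
  have GFi : G \subset F :\ i by rewrite subsetD1 GL.
  have cFi : #|F :\ i| = #|G|.+1 by move: Fp; rewrite (cardsD1 i) iF => -[].
  rewrite (sL _ _ FL GFi (subsetDl _ _)) cFi eqxx ifT //=.
  have : (0 < #|(F :\ i) :\: G|)%N by rewrite cardsD (setIidPr GFi) cFi subSnn.
  case/card_gt0P => z /[dup] zF' /setDP[/setD1P[_ zF] zG]; apply/pred0Pn; exists z => /=.
  by rewrite zF' (subsetP FC) // inE zG.
have b0 F : ~~ (G \subset F) -> b F = 0.
  by move=> h; apply: bs; apply: contraNN h => /GL.
have cE y : y \notin G -> y |: G \in L -> c (y |: G) = (y \in C)%:R * inc_sign R y (y |: G).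
  move=> yG yL; rewrite /c yL cardsU1 yG add1n eqxx /=.
  have -> : (y |: G) :\: G = [set y] by rewrite setDUl setDv setU0; apply/setDidPl; rewrite disjoints1.
  rewrite disjoints1 negbK; case: (y \in C); rewrite ?mul0r // mul1r.
  by rewrite coboundary_setU1 // /one_G eqxx mulr1.
(* The value at [v |: G] forces [b G = 1]; the value at [x |: G], where [c] vanishes, then makes a
   sign equal to 0. *)
have := bE _ vL; rewrite cardsU1 vG => /(_ erefl).
rewrite cE // vC mul1r coboundary_setU1 // => /(congr1 ( *%R (inc_sign R v (v |: G)))).
rewrite mulrA inc_sign_sqr mul1r => bG.
have := bE _ xL; rewrite cardsU1 xG => /(_ erefl).
rewrite cE // (negPf xC) mul0r coboundary_setU1 // -bG mulr1 => /esym/eqP.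
by rewrite signr_eq0.
Qed.

(** The indicator of [G] is a cocycle, and there is no smaller member to carry a primitive. This
    will exclude facets of too small size. *)
Lemma acyclic_set1 G : ~ acyclic R [set G] #|G|.
Proof.
move=> acG; pose one_G F : R := (F == G)%:R.
have [|F /set1P -> /esym/eqP|b bs bE] := acG one_G.
- by move=> F; rewrite inE /one_G => /negPf ->.
- by rewrite eqn_leq ltnn.
have := bE G (set11 G) erefl; rewrite /one_G eqxx coboundary0 => [/eqP|i iG].
  by rewrite oner_eq0.
by apply: bs; rewrite inE; apply: contraTneq iG => <-; rewrite !inE eqxx.
Qed.

End LowDegrees.

(** * Connected complexes whose vertex links are matroids *)

Section LocalToGlobal.

Variable n : nat.
Implicit Types (i j t u v w x y z : 'I_n) (F G H U C : {set 'I_n}).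
Variable E : {set {set 'I_n}}.

(** [Eloc] is basis exchange in the vertex links, phrased without forming links; [Eext] provides
    triangles on every edge; [Econn] is connectedness in terms of edge-closed vertex sets. *)
Hypothesis Esub : forall F H, F \in E -> H \subset F -> H \in E.
Hypothesis Eext : forall F, F \in E -> exists H, [/\ H \in E, F \subset H & (2 < #|H|)%N].
Hypothesis Eloc : forall v F H, F \in E -> H \in E -> v \in F -> v \in H ->
  (#|H| < #|F|)%N -> exists2 i, i \in F :\: H & i |: H \in E.
Hypothesis Econn : forall C u, u \in C -> [set u] \in E ->
  (forall v w, v \in C -> [set v; w] \in E -> w \in C) ->
  forall w, [set w] \in E -> w \in C.

Let sub3 a b c F : F \in E -> a \in F -> b \in F -> c \in F -> [set a; b; c] \in E.
Proof. by move=> FE aF bF cF; apply: Esub FE _; rewrite !subUset !sub1set aF bF cF. Qed.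

Let sub2 a b F : F \in E -> a \in F -> b \in F -> [set a; b] \in E.
Proof. by move=> FE aF bF; apply: Esub FE _; rewrite !subUset !sub1set aF bF. Qed.

Ltac mem := by rewrite !inE !eqxx ?orbT.

(* In the link of [v], the vertices [u] and [w] are parallel. *)
Let parallel u v w t : [set v; w] \in E -> [set u; v; t] \in E ->
  u != v -> u != t -> v != t -> [set u; v; w] \notin E -> [set t; v; w] \in E.
Proof.
move=> vwE uvtE uv ut vt uvwE.
have [] := @Eloc v [set u; v; t] [set v; w] uvtE vwE; try mem.
  rewrite cards2 -(setUC [set t]) cardsU1 !inE !(eq_sym t) negb_or ut vt cards2 uv.
  by case: (v != w).
move=> i; rewrite !inE negb_or => /andP[/andP[iv iw] /orP[/orP[/eqP->|iv']|/eqP->]] h.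
- by case/negP: uvwE; apply: sub3 h _ _ _; mem.
- by rewrite iv' in iv.
- by apply: sub3 h _ _ _; mem.
Qed.

Let third u v : [set u; v] \in E ->
  exists t, [/\ [set u; v; t] \in E, t != u & t != v].
Proof.
move=> /Eext[H [HE uvH cH]].
have : (0 < #|H :\: [set u; v]|)%N.
  by rewrite cardsD subn_gt0 (setIidPr uvH) cards2; case: (u != v); lia.
case/card_gt0P => t; rewrite !inE negb_or => /andP[/andP[tu tv] tH].
exists t; split => //; apply: sub3 HE _ _ _ => //.
  by apply: (subsetP uvH); mem.
by apply: (subsetP uvH); mem.
Qed.

(** The vertices at distance at most 2 from [u] are closed under edges: a path [u, v, w, z] without
    shortcut is shortened through a [t] completing [v, w] to a triangle, since [u, w] are parallel
    in the link of [v] and [v, z] in the link of [w]. *)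
Let dist2 u w : [set u] \in E -> [set w] \in E ->
  [set u; w] \in E \/ exists v, [set u; v] \in E /\ [set v; w] \in E.
Proof.
move=> uE wE.
pose C := [set w | ([set u; w] \in E) || [exists v, ([set u; v] \in E) && ([set v; w] \in E)]].
suff: w \in C.
  rewrite inE => /orP[|/existsP[v /andP[uv vw]]]; [by left|by right; exists v].
apply: (@Econn C u) => // {w wE}; first by rewrite inE setUid uE.
move=> w z; rewrite [w \in C]inE => /orP[uw|/existsP[v /andP[uv vw]]] wz; rewrite inE.
  by apply/orP; right; apply/existsP; exists w; rewrite uw wz.
case: (boolP ([set u; w] \in E)) => uw.
  by apply/orP; right; apply/existsP; exists w; rewrite uw wz.
case: (boolP ([set v; z] \in E)) => vz.
  by apply/orP; right; apply/existsP; exists v; rewrite uv vz.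
have uvw : [set u; v; w] \notin E.
  by apply: contraNN uw => h; apply: sub2 h _ _; mem.
have vwz : [set v; w; z] \notin E.
  by apply: contraNN vz => h; apply: sub2 h _ _; mem.
have [t [vwt tv tw]] := third vw.
have v_w : v != w by apply: contraNneq uw => <-.
have tvu : [set t; v; u] \in E.
  apply: (@parallel w); rewrite 1?eq_sym //.
  - by apply: sub2 uv _ _; mem.
  - by apply: sub3 vwt _ _ _; mem.
  - by apply: contraNN uvw => h; apply: sub3 h _ _ _; mem.
have twz : [set t; w; z] \in E.
  by apply: (@parallel v); rewrite // 1?eq_sym.
apply/orP; right; apply/existsP; exists t; apply/andP; split.
  by apply: sub2 tvu _ _; mem.
by apply: sub2 twz _ _; mem.
Qed.

(** This makes non-adjacency transitive. Were [z] not adjacent to [w], take a common neighbour [v]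
    of [u] and [w], and a triangle [u, v, t]: parallel pairs in the links of [u], of [v] and then of
    [t] produce the triangle [z, t, w]. *)
Let nonadj_trans u w z : [set w] \in E -> [set u; z] \in E -> u != z ->
  [set u; w] \notin E -> [set z; w] \in E.
Proof.
move=> wE uz u_z uw; apply/negPn/negP => zw.
have uE : [set u] \in E by rewrite -[X in X \in E]setUid; apply: sub2 uz _ _; mem.
have [h|[v [uv vw]]] := dist2 uE wE; first by rewrite h in uw.
have u_v : u != v by apply: contraNneq uw => ->.
have z_v : z != v by apply: contraNneq zw => ->.
have uvw : [set u; v; w] \notin E.
  by apply: contraNN uw => h; apply: sub2 h _ _; mem.
have uvz : [set u; v; z] \notin E.
  apply: contraNN zw => h.
  have : [set z; v; w] \in E by apply: (@parallel u) => //; rewrite eq_sym.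
  by move=> h'; apply: sub2 h' _ _; mem.
have [t [uvt tu tv]] := third uv.
have tuz : [set t; u; z] \in E.
  apply: (@parallel v); rewrite // 1?eq_sym //.
  - by apply: sub3 uvt _ _ _; mem.
  - by apply: contraNN uvz => h; apply: sub3 h _ _ _; mem.
have tvw : [set t; v; w] \in E by apply: (@parallel u); rewrite // eq_sym.
have : [set z; t; w] \in E.
  apply: (@parallel u); rewrite // 1?eq_sym //.
  - by apply: sub2 tvw _ _; mem.
  - by apply: sub3 tuz _ _ _; mem.
  - by apply: contraNneq uvz => ->.
  - by apply: contraNN uw => h; apply: sub2 h _ _; mem.
by move=> h; case/negP: zw; apply: sub2 h _ _; mem.
Qed.

(** Faces sharing a vertex exchange by [Eloc], so [F] is replaced by a face [F'] of the same size
    that contains a vertex [v] of [G] and otherwise lies in [F]. The element gained from [F'] is not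
    [v], hence comes from [F]. *)
Lemma locally_matroid : matroid E.
Proof.
move=> F G FE GE GF.
case: (set_0Vmem G) => [G0|[v vG]].
  have /card_gt0P[i iF] : (0 < #|F|)%N by apply: leq_ltn_trans GF.
  exists i; first by rewrite G0 setD0.
  by rewrite G0 setU0; apply: Esub FE _; rewrite sub1set.
(* Two distinct elements of [F] are adjacent, so by [nonadj_trans] one of them is adjacent or equal
   to [v]. *)
have [f fF fv] : exists2 f, f \in F & [set v; f] \in E.
  have G0 : (0 < #|G|)%N by apply/card_gt0P; exists v.
  have /card_gt1P[f [g [fF gF fg]]] : (1 < #|F|)%N by lia.
  case: (boolP ([set f; v] \in E)) => h; first by exists f => //; apply: sub2 h _ _; mem.
  exists g => //.
  have : [set g; v] \in E.
    apply: nonadj_trans h => //; last by apply: sub2 FE _ _.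
    by apply: Esub GE _; rewrite sub1set.
  by move=> h'; apply: sub2 h' _ _; mem.
(* Enlarging {v, f} inside the link of f gives a face with v of size |F|. *)
have [F' [F'E vF' F'F cF']] : exists F', [/\ F' \in E, v \in F', F' \subset v |: F & #|F'| = #|F|].
  case: (boolP (v \in F)) => vF; first by exists F; split=> //; apply: subsetUr.
  have v_f : v != f by apply: contraNneq vF => ->.
  suff H k : (1 < k <= #|F|)%N ->
      exists F', [/\ F' \in E, [set v; f] \subset F', F' \subset v |: F & #|F'| = k].
    have [|F' [F'E vfF F'F cF]] := H #|F|.
      rewrite leqnn andbT; apply: leq_ltn_trans GF; apply/card_gt0P; by exists v.
    by exists F'; split=> //; apply: (subsetP vfF); mem.
  elim: k => // k IH /andP[]; rewrite ltnS leq_eqVlt => /orP[/eqP<- _|k1 kF].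
    exists [set v; f]; split=> //; last by rewrite cards2 v_f.
    by apply: setUS; rewrite sub1set.
  have [|F' [F'E vfF F'F cF']] := IH; first by rewrite k1 ltnW.
  have [] := @Eloc f F F' FE F'E fF; rewrite ?cF' //.
    by apply: (subsetP vfF); mem.
  move=> i /setDP[iF iF'] iE; exists (i |: F'); split => //.
  - by apply: subset_trans vfF (subsetUr _ _).
  - by rewrite subUset F'F andbT sub1set inE iF orbT.
  - by rewrite cardsU1 iF' cF'.
have [i /setDP[iF' iG] iE] : exists2 i, i \in F' :\: G & i |: G \in E.
  by apply: (@Eloc v) => //; rewrite cF'.
exists i => //; rewrite inE iG; have := subsetP F'F _ iF'.
by case/setU1P => // iv; rewrite iv vG in iG.
Qed.

End LocalToGlobal.

(** * The families attached to multidegrees *)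

Section DegreeFamily.

Variables (R : comNzRingType) (n : nat).
Implicit Types (i j v x y : 'I_n) (F G H U C : {set 'I_n}) (D L : {set {set 'I_n}}).
Implicit Types (w : 'I_n -> nat).

Definition degree_family D (m : nat) G w : {set {set 'I_n}} :=
  [set F : {set 'I_n} | (G \subset F) &&
     [exists H in facets D, (F \subset H) && (\sum_(i in ~: H) w i < m)%N]].

Lemma degree_familyP D m G w F :
  reflect (G \subset F /\ exists H, [/\ H \in facets D, F \subset H
                                      & (\sum_(i in ~: H) w i < m)%N])
    (F \in degree_family D m G w).
Proof.
rewrite inE; apply: (iffP andP) => [[GF /existsP[H /and3P[]]]|[GF [H [HD FH Hm]]]].
  by move=> HD FH Hm; split=> //; exists H.
by split=> //; apply/existsP; exists H; rewrite HD FH Hm.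
Qed.

Lemma facetsP D H :
  reflect (H \in D /\ forall F, F \in D -> H \subset F -> F = H) (H \in facets D).
Proof. by rewrite inE; apply: maxsetP. Qed.

Lemma subset_facet D F : F \in D -> exists2 H, H \in facets D & F \subset H.
Proof. by move=> /maxset_exists[H Hmax FH]; exists H; rewrite ?inE. Qed.

(** A facet omitting [i] has weight at least [m] outside it, so every admissible facet contains [i]
    and the family is a cone over [i]. *)
Lemma acyclic_degree_family_big D m G w i p :
  i \notin G -> (m <= w i)%N -> acyclic R (degree_family D m G w) p.
Proof.
move=> iG wi; apply: (@acyclic_cone _ _ _ i) => F /degree_familyP[GF [H [HD FH Hm]]].
  have iH : i \in H.
    by apply: contraLR Hm => iH; rewrite -leqNgt (bigD1 i) ?inE //= (leq_trans wi) ?leq_addr.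
  apply/degree_familyP; split; first by apply: subset_trans GF (subsetUr _ _).
  by exists H; split; rewrite // subUset sub1set iH.
apply/degree_familyP; split; first by rewrite subsetD1 GF.
by exists H; split=> //; apply: subset_trans FH; apply: subsetDl.
Qed.

Lemma acyclic_set0 p : acyclic R (set0 : {set {set 'I_n}}) p.
Proof. by move=> c cs _; exists (fun=> 0) => // F; rewrite inE. Qed.

Lemma leq_card_max D F : F \in D -> (#|F| <= \max_(F in D) #|F|)%N.
Proof. by move=> FD; apply: (leq_bigmax_cond (P := mem D) (F := fun F : {set _} => #|F|)). Qed.

Lemma card_facet_matroid D H : matroid D -> H \in facets D ->
  #|H| = (\max_(F in D) #|F|)%N.
Proof.
move=> Dmat /facetsP[HD Hmax]; apply/eqP; rewrite eqn_leq leq_card_max //=.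
apply/bigmax_leqP => F FD; rewrite leqNgt; apply/negP => HF.
have [i /setDP[_ /negP iH] iD] := Dmat F H FD HD HF; apply: iH.
by rewrite -(Hmax _ iD) ?setU11 // subsetUr.
Qed.

(** The faces containing the nonempty [G] all lie in one summand [M j]. As the dimensions agree, the
    facets of [D] there are the bases of [M j], so the family is a [heavy_interval]. *)
Lemma acyclic_disjoint_matroids D m G w p :
  disjoint_union_of_matroids D -> G != set0 -> (p < \max_(F in D) #|F|)%N ->
  acyclic R (degree_family D m G w) p.
Proof.
move=> [k [V [M [VM dV dM DE]]]] /set0Pn[g gG] pd.
case: (set_0Vmem (degree_family D m G w)) => [->|]; first exact: acyclic_set0.
case=> F0 /degree_familyP[GF0 [H0 [/facetsP[H0D _] /(subset_trans GF0) GH0 _]]] {F0 GF0}.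
have /bigcupP[j _ H0j] : H0 \in \bigcup_j M j by rewrite -DE.
have [[MjV Msub _] Mmat] := VM j.
have inMj H : H \in D -> G \subset H -> H \in M j.
  rewrite DE => /bigcupP[l _ Hl] GH; suff -> : j = l by [].
  apply/eqP/negPn/negP => /dV /pred0Pn[]; exists g => /=.
  have [[MlV _ _] _] := VM l.
  by rewrite (subsetP (MjV _ H0j)) ?(subsetP (MlV _ Hl)) ?(subsetP GH) ?(subsetP GH0).
have MD H l : H \in M l -> H \in D by move=> Hl; rewrite DE; apply/bigcupP; exists l.
have rk : (\max_(F in M j) #|F| = \max_(F in D) #|F|)%N.
  have dM' l : (\max_(F in M l) #|F| = \max_(F in M j) #|F|)%N.
    by have := dM l j; rewrite /dim_complex => /addIr [].
  apply/eqP; rewrite eqn_leq; apply/andP; split; apply/bigmax_leqP => F.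
    by move=> /MD; apply: leq_card_max.
  rewrite {1}DE => /bigcupP[l _ Fl]; rewrite -(dM' l); exact: leq_card_max.
have sumE H : (\sum_i w i = \sum_(i in H) w i + \sum_(i in ~: H) w i)%N.
  by rewrite (bigID (fun i => i \in H)) /=; congr addn; apply: eq_bigl => i; rewrite inE.
(* Weight below [m] outside [H] means weight at least the total plus 1 minus [m] inside; truncation
   of this difference at 0 is harmless. *)
have -> : degree_family D m G w =
    heavy_interval (M j) (\max_(F in M j) #|F|) w ((\sum_i w i).+1 - m) G setT.
  apply/setP => F; apply/degree_familyP/heavy_intervalP => -[GF [H]].
    case=> /facetsP[HD Hmax] FH Hm; split=> //; exists H; split=> //; rewrite ?subsetT //.
    - exact: inMj (subset_trans GF FH).
    - apply: card_facet_matroid => //; apply/facetsP; split; first exact: inMj (subset_trans GF FH).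
      by move=> F' /MD; apply: Hmax.
    - by move: Hm; rewrite (sumE H); lia.
  case=> HM FH _ Hr Hm; split=> //; exists H; split=> //.
    apply/facetsP; split; first exact: MD HM.
    move=> F' F'D HF'; apply/esym/eqP; rewrite eqEcard HF' /= Hr rk.
    exact: leq_card_max.
  by move: Hm; rewrite (sumE H); lia.
by apply: heavy_interval_acyclic; rewrite ?subsetT ?rk.
Qed.

End DegreeFamily.

(** * Links of faces *)

Section Links.

Variable n : nat.
Implicit Types (i j v x y : 'I_n) (F G H U C : {set 'I_n}) (D L : {set {set 'I_n}}).

Definition link D G : {set {set 'I_n}} :=
  [set F : {set 'I_n} | [disjoint F & G] && (F :|: G \in D)].

Lemma disjoint_setU1 v F G : [disjoint v |: F & G] = (v \notin G) && [disjoint F & G].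
Proof. by rewrite !disjoints_subset subUset sub1set inE. Qed.

Lemma in_linkD D G F : G \subset F -> F \in D -> F :\: G \in link D G.
Proof.
move=> GF FD; rewrite inE disjoint_sym disjoints_subset setCD subsetUr /=.
by rewrite setUC -{1}(setIidPr GF) setID.
Qed.

Lemma link_exchange D G F H : matroid (link D G) -> F \in D -> H \in D ->
  G \subset F -> G \subset H -> (#|H| < #|F|)%N ->
  exists2 i, i \in F :\: H & i |: H \in D.
Proof.
move=> mat FD HD GF GH HF.
have [] := mat (F :\: G) (H :\: G); rewrite ?in_linkD //.
  by rewrite !cardsD (setIidPr GF) (setIidPr GH) ltn_sub2r // (leq_ltn_trans _ HF) // subset_leq_card.
move=> i; rewrite !inE negb_and negbK => /andP[/orP[iG|iH] /andP[iG' iF]].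
  by rewrite iG in iG'.
case/andP => _ iD; exists i; first by rewrite inE iH.
by move: iD; rewrite -setUA [_ :\: _ :|: _]setUC -{1}(setIidPr GH) setID.
Qed.

End Links.

(** * Purity, matroid links and components from vanishing *)

Section MatroidComponents.

Variables (R : comNzRingType) (n : nat) (D : {set {set 'I_n}}) (m : nat).
Implicit Types (i v x y : 'I_n) (F G H U C : {set 'I_n}).
Implicit Types (w : 'I_n -> nat).

Let d := (\max_(F in D) #|F|)%N.

Hypothesis Dcomplex : simplicial_complex [set: 'I_n] D.
Hypothesis d_gt2 : (2 < d)%N.
Hypothesis m_gt2 : (2 < m)%N.
Hypothesis Dacyclic : forall G w p, G != set0 -> (p < d)%N ->
  acyclic R (degree_family D m G w) p.

Let Dsub F H : F \in D -> H \subset F -> H \in D.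
Proof. by case: Dcomplex => _ h _; apply: h. Qed.

Let Dvertex i : [set i] \in D.
Proof. by case: Dcomplex => _ _ h; apply: h; rewrite inE. Qed.

Let n_gt0 : (0 < n)%N.
Proof.
have : (d <= n)%N by apply/bigmax_leqP => F _; rewrite -[X in (_ <= X)%N]card_ord max_card.
by lia.
Qed.

(** With zero weights the family above a facet [H] is [[set H]], which is not acyclic in degree
    [#|H|], so [#|H| < d] is impossible. The vertex coming from [n_gt0] shows that [H] is
    nonempty. *)
Lemma card_facet H : H \in facets D -> #|H| = d.
Proof.
move=> Hf; have /facetsP[HD Hmax] := Hf.
have HN0 : H != set0.
  apply/eqP => H0; have := Hmax _ (Dvertex (Ordinal n_gt0)).
  rewrite H0 sub0set => /(_ isT)/setP/(_ (Ordinal n_gt0)).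
  by rewrite !inE eqxx.
apply/eqP; rewrite eqn_leq leq_card_max //= leqNgt; apply/negP => Hd.
have := @Dacyclic H (fun=> 0%N) _ HN0 Hd.
have -> : degree_family D m H (fun=> 0%N) = [set H].
  apply/setP => F; rewrite in_set1; apply/degree_familyP/eqP => [[HF [H' [H'f FH' _]]]|->].
    have /facetsP[H'D _] := H'f.
    have H'H := Hmax _ H'D (subset_trans HF FH').
    by apply/eqP; rewrite eqEsubset HF andbT -H'H.
  by split=> //; exists H; split=> //; rewrite big1 //; lia.
exact: acyclic_set1.
Qed.

Lemma face_extend F : F \in D -> exists H, [/\ H \in D, F \subset H & #|H| = d].
Proof.
move=> /subset_facet[H Hf FH]; exists H; split=> //; last exact: card_facet.
by case/facetsP: Hf.
Qed.

Let facet_card H : H \in D -> #|H| = d -> H \in facets D.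
Proof.
move=> HD Hd; apply/facetsP; split=> // F FD HF.
by apply/esym/eqP; rewrite eqEcard HF Hd leq_card_max.
Qed.

Let connected_above G w C : G != set0 -> (#|G|.+1 < d)%N ->
  (forall v x, v \in C -> v \notin G -> x \notin G -> v |: (x |: G) \in degree_family D m G w -> x \in C) ->
  forall v x, v \in C -> v \notin G -> v |: G \in degree_family D m G w ->
    x \notin G -> x |: G \in degree_family D m G w -> x \in C.
Proof.
move=> GN0 Gd hC; apply: (acyclic_connected _ _ (@Dacyclic G w _ GN0 Gd)) => //.
  by move=> F /degree_familyP[].
move=> F F' /degree_familyP[_ [H [Hf FH Hm]]] GF' F'F.
by apply/degree_familyP; split=> //; exists H; split=> //; apply: subset_trans FH.
Qed.

Lemma degree_family0 G F : (F \in degree_family D m G (fun=> 0%N)) = (G \subset F) && (F \in D).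
Proof.
apply/degree_familyP/andP => [[GF [H [/facetsP[HD _] FH _]]]|[GF /subset_facet[H Hf FH]]].
  by split=> //; apply: Dsub FH.
by split=> //; exists H; split=> //; rewrite big1 //; lia.
Qed.

(* If v3 is adjacent in the link to neither end of the edge v1 v2, the weights
   (1, m - 2, m - 1) on (v1, v2, v3) select exactly the edge v1 v2 and the edges
   through v3: a disconnected graph. *)
Let link_edge G v1 v2 v3 : G != set0 -> #|G|.+2 = d -> G \in D ->
  v1 \notin G -> v2 \notin G -> v3 \notin G -> v1 != v2 -> v1 != v3 -> v2 != v3 ->
  v1 |: (v2 |: G) \in D -> v3 |: G \in D ->
  v1 |: (v3 |: G) \notin D -> v2 |: (v3 |: G) \notin D -> False.
Proof.
move=> GN0 Gd GD v1G v2G v3G n12 n13 n23 e12 e3 e13 e23.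
(* A facet through [v3] misses weight at most 1 + (m - 2) < m. A facet missing [v3] already misses m
   - 1 and can afford neither 1 nor m - 2 more, both being positive. *)
pose w v := if v == v1 then 1%N else if v == v2 then (m - 2)%N else if v == v3 then (m - 1)%N else 0%N.
have wsum (S : {set 'I_n}) :
  (\sum_(i in S) w i = (v1 \in S) * 1 + (v2 \in S) * (m - 2) + (v3 \in S) * (m - 1))%N.
  have wE i : w i = ((i == v1) * 1 + (i == v2) * (m - 2) + (i == v3) * (m - 1))%N.
    rewrite /w; case: (i =P v1) => [->|_]; first by rewrite (negPf n12) (negPf n13) !addn0.
    case: (i =P v2) => [->|_]; first by rewrite (negPf n23) addn0 mul1n.
    by case: (i == v3); rewrite ?mul1n.
  have del v c : (\sum_(i in S) (i == v) * c = (v \in S) * c)%N.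
    rewrite -big_distrl /=; congr muln; case: (boolP (v \in S)) => vS.
      by rewrite (bigD1 v) //= eqxx big1 // => i /andP[_ /negPf ->].
    by rewrite big1 // => i iS; case: eqP iS vS => // -> ->.
  by rewrite (eq_bigr _ (fun i _ => wE i)) !big_split /= !del.
clearbody w.
have facet12 H : H \in facets D -> G \subset H -> (\sum_(i in ~: H) w i < m)%N ->
    (v1 \in H) || (v2 \in H) -> (v1 \in H) && (v2 \in H) && (v3 \notin H).
  move=> /facetsP[HD _] GH; rewrite wsum !inE => Hm.
  have h13 : v3 \in H -> v1 \notin H.
    move=> v3H; apply: contraNN e13 => v1H; apply: Dsub HD _.
    by rewrite !subUset !sub1set v1H v3H.
  have h23 : v3 \in H -> v2 \notin H.
    move=> v3H; apply: contraNN e23 => v2H; apply: Dsub HD _.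
    by rewrite !subUset !sub1set v2H v3H.
  case: (boolP (v3 \in H)) => v3H; first by rewrite (negPf (h13 v3H)) (negPf (h23 v3H)).
  by move: Hm m_gt2; rewrite v3H; clear; case: (v1 \in H); case: (v2 \in H) => //=; lia.
(* No edge of this family leaves the pair of [v1] and [v2], so connectedness would put [v3] into
   that pair. *)
have in12 : v3 \in [set v1; v2].
  apply: (@connected_above G w _ GN0 _ _ v1 v3) => //.
  - by rewrite -Gd.
  - move=> v x vC _ xG /degree_familyP[_ [H [Hf vxH Hm]]].
    move: vxH; rewrite !subUset !sub1set => /and3P[vH xH GH].
    have /andP[/andP[v1H v2H] v3H] : (v1 \in H) && (v2 \in H) && (v3 \notin H).
      apply: facet12 => //; by case/set2P: vC vH => -> ->; rewrite ?orbT.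
    have -> : [set v1; v2] = H :\: G; last by rewrite inE xG.
    apply/eqP; rewrite eqEcard cards2 n12 cardsD (setIidPr GH) (card_facet Hf) -Gd.
    apply/andP; split; last by rewrite -[#|G|.+2]addn2 addKn.
    by rewrite subUset !sub1set !inE v1H v2H v1G v2G.
  - by rewrite !inE eqxx.
  - apply/degree_familyP; split; first exact: subsetUr.
    exists (v1 |: (v2 |: G)); split.
    + apply: facet_card => //; by rewrite !cardsU1 !inE negb_or n12 v1G v2G /= -Gd.
    + by apply: setUS; apply: subsetUr.
    + rewrite wsum !inE !eqxx /= !(eq_sym v3) (negPf n13) (negPf n23) (negPf v3G) !orbT /=; move: m_gt2; clear; lia.
  apply/degree_familyP; split; first exact: subsetUr.
  have [H [HD vH Hd]] := face_extend e3; exists H; split=> //; first exact: facet_card.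
  move: (vH); rewrite subUset sub1set => /andP[v3H _].
  by rewrite wsum !inE v3H /=; move: m_gt2; clear; case: (v1 \in H); case: (v2 \in H) => /=; lia.
by case/set2P: in12 => h; rewrite h eqxx in n13 n23.
Qed.

Lemma link_subset G F H : F \in link D G -> H \subset F -> H \in link D G.
Proof.
rewrite !inE => /andP[dFG FD] HF; rewrite (disjointWl HF dFG) /=.
by apply: Dsub FD _; apply: setSU.
Qed.

(** Induction on the dimension of the link. In dimension 1 the essential case, an edge against a
    vertex off it, is [link_edge]. Above that, vertex links of the link are links of [v |: G], zero
    weights give connectedness, and [locally_matroid] applies. *)
Lemma link_matroid G : G \in D -> G != set0 -> (#|G|.+1 < d)%N -> matroid (link D G).
Proof.
move=> GD GN0 Gd; move: {2}(d - #|G|.+2)%N (erefl (d - #|G|.+2)%N) => k.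
elim: k G GD GN0 Gd => [|k IH] G GD GN0 Gd Gk.
  have {}Gk : #|G|.+2 = d by lia.
  move=> F H FE HE HF.
  have /andP[dFG FD] : [disjoint F & G] && (F :|: G \in D) by move: FE; rewrite inE.
  have /andP[dHG HD] : [disjoint H & G] && (H :|: G \in D) by move: HE; rewrite inE.
  have cF : (#|F| <= 2)%N.
    have := leq_card_max FD; rewrite cardsU; move: dFG; rewrite -setI_eq0 => /eqP ->.
    by rewrite cards0 -/d; move: Gk; clear; lia.
  have [H0|[v3 v3H]] := set_0Vmem H.
    have /card_gt0P[i iF] : (0 < #|F|)%N by apply: leq_ltn_trans HF.
    exists i; first by rewrite H0 setD0.
    by rewrite H0 setU0; apply: link_subset FE _; rewrite sub1set.
  have cH : (0 < #|H|)%N by apply/card_gt0P; exists v3.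
  have /cards2P[v1 [v2 [n12 FE12]]] : #|F| == 2 by move: cF HF cH; clear; lia.
  have {cH} HE3 : H = [set v3].
    by apply/esym/eqP; rewrite eqEcard sub1set v3H cards1; move: cF HF cH; clear; lia.
  have inF i : i \in F -> i \notin G.
    by move=> iF; have := disjointFr dFG iF => ->.
  have v1F : v1 \in F by rewrite FE12 !inE eqxx.
  have v2F : v2 \in F by rewrite FE12 !inE eqxx orbT.
  have v3G : v3 \notin G by have := disjointFr dHG v3H => ->.
  case: (boolP (v3 \in F)) => v3F.
    have [i iF i3] : exists2 i, i \in F & i != v3.
      case: (altP (v1 =P v3)) => h; last by exists v1.
      by exists v2 => //; rewrite -h eq_sym.
    exists i; first by rewrite HE3 !inE i3.
    by apply: link_subset FE _; rewrite HE3 subUset !sub1set iF v3F.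
  have n13 : v1 != v3 by apply: contraNneq v3F => <-.
  have n23 : v2 != v3 by apply: contraNneq v3F => <-.
  have linkE i : i \in F -> (i |: H \in link D G) = (i |: (v3 |: G) \in D).
    move=> iF; rewrite inE HE3 setUA andb_idl // => _.
    by rewrite disjoint_setU1 inF // disjoints1.
  case: (boolP (v1 |: (v3 |: G) \in D)) => e13; first by exists v1; rewrite ?linkE // inE HE3 inE n13.
  case: (boolP (v2 |: (v3 |: G) \in D)) => e23; first by exists v2; rewrite ?linkE // inE HE3 inE n23.
  case: (@link_edge G v1 v2 v3); rewrite // ?inF //.
    by rewrite setUA -FE12.
  by move: HD; rewrite HE3.
apply: locally_matroid.
- by move=> F H; apply: link_subset.
- move=> F; rewrite inE => /andP[dFG FD].
  have [H [HD FH Hd]] := face_extend FD.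
  have GH : G \subset H by apply: subset_trans FH; apply: subsetUr.
  exists (H :\: G); split; first exact: in_linkD.
    by rewrite subsetD dFG andbT; apply: subset_trans FH; apply: subsetUl.
  by rewrite cardsD (setIidPr GH) Hd; move: Gk; clear; lia.
- move=> v F H; rewrite !inE => /andP[dFG FD] /andP[dHG HD] vF vH HF.
  have vG : v \notin G by rewrite (disjointFr dFG vF).
  have vGD : v |: G \in D by apply: Dsub FD _; apply: setSU; rewrite sub1set.
  have mat : matroid (link D (v |: G)).
    have cv : #|v |: G| = #|G|.+1 by rewrite cardsU1 vG.
    apply: IH => //; first by apply/set0Pn; exists v; rewrite setU11.
      by rewrite cv; move: Gk; clear; lia.
    by rewrite cv; move: Gk; clear; lia.
  have [|||i] := link_exchange mat FD HD; rewrite ?setSU ?sub1set //.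
    move: dFG dHG; rewrite !cardsU -!setI_eq0 => /eqP -> /eqP ->; rewrite cards0; move: HF; clear; lia.
  rewrite !inE negb_or => /andP[/andP[iH iG] /orP[iF|iG']] iD; last by rewrite iG' in iG.
  exists i; first by rewrite inE iH.
  by rewrite inE -setUA disjoint_setU1 iG dHG.
move=> C u uC; rewrite inE => /andP[uG uD] hC w; rewrite inE => /andP[wG wD].
rewrite !disjoints1 in uG wG.
apply: (@connected_above G (fun=> 0%N) C GN0 Gd _ u w) => //.
- move=> v x vC vG xG; rewrite degree_family0 => /andP[_ vxD].
  apply: hC vC _; by rewrite inE -setUA vxD andbT disjoint_setU1 vG disjoints1.
- by rewrite degree_family0 subsetUr.
by rewrite degree_family0 subsetUr.
Qed.

(** The summands are the connected components of the edge graph, indexed by its roots. Every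
    nonempty face is a clique, so it lies in one component; there [link_matroid] for single vertices
    feeds [locally_matroid]. *)
Lemma disjoint_matroids_of_acyclic : disjoint_union_of_matroids D.
Proof.
pose e : rel 'I_n := fun u v => [set u; v] \in D.
have e_sym : ssrbool.symmetric e by move=> u v; rewrite /e setUC.
have c_sym : connect_sym e by apply: sym_connect_sym.
pose k := #|roots e|.
pose V (j : 'I_k) := [set x | fingraph.root e x == enum_val j].
pose M (j : 'I_k) := [set F in D | F \subset V j].
have eD F x y : F \in D -> x \in F -> y \in F -> e x y.
  by move=> FD xF yF; apply: Dsub FD _; rewrite subUset !sub1set xF.
have eV j x y : e x y -> x \in V j -> y \in V j.
  by rewrite !inE => exy /eqP <-; apply/eqP; rewrite (fingraph.rootP c_sym (connect1 exy)).
have cliqueV j F x : F \in D -> x \in F -> x \in V j -> F \subset V j.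
  by move=> FD xF xV; apply/subsetP => y yF; apply: eV xV; apply: eD FD _ _.
have idx x : exists j : 'I_k, x \in V j.
  have rx : fingraph.root e x \in roots e by apply: roots_root.
  by exists (enum_rank_in rx (fingraph.root e x)); rewrite inE enum_rankK_in.
have V0 j : exists x, x \in V j.
  exists (enum_val j); rewrite inE; apply/eqP.
  by have := enum_valP j; rewrite unfold_in => /eqP.
have facetV j F : F \in M j -> exists H, [/\ H \in M j, F \subset H & #|H| = d].
  have aux x F' : F' \in D -> x \in F' -> x \in V j -> exists H, [/\ H \in M j, F' \subset H & #|H| = d].
    move=> F'D xF' xV; have [H [HD FH Hd]] := face_extend F'D.
    by exists H; split=> //; rewrite inE HD (cliqueV j _ x) // (subsetP FH).
  rewrite inE => /andP[FD FV]; have [F0|[x xF]] := set_0Vmem F.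
    have [x xV] := V0 j; have [H [HM _ Hd]] := aux x _ (Dvertex x) (set11 x) xV.
    by exists H; split=> //; rewrite F0 sub0set.
  by apply: (aux x) => //; apply: (subsetP FV).
have Msub j F H : F \in M j -> H \subset F -> H \in M j.
  rewrite !inE => /andP[FD FV] HF; rewrite (Dsub FD HF); exact: subset_trans HF FV.
exists k, V, M; split.
- move=> j; split.
    split=> [F|F H|i iV]; first by rewrite inE => /andP[].
      exact: Msub.
    by rewrite inE Dvertex sub1set.
  apply: locally_matroid.
  + exact: Msub.
  + move=> F /facetV[H [HM FH Hd]]; exists H; split=> //; by rewrite Hd.
  + move=> v F H; rewrite !inE => /andP[FD FV] /andP[HD HV] vF vH HF.
    have mat : matroid (link D [set v]).
      apply: link_matroid => //; last by rewrite cards1.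
      by apply/set0Pn; exists v; rewrite set11.
    have [||i iFH iD] := link_exchange mat FD HD _ _ HF; rewrite ?sub1set //.
    exists i => //; rewrite inE iD subUset HV sub1set andbT.
    by case/setDP: iFH => /(subsetP FV).
  move=> C u uC; rewrite !inE sub1set => /andP[_ uV] hC w; rewrite !inE sub1set => /andP[_ wV].
  have ca : closed e [predI C & V j].
    apply: intro_closed => // x y exy /andP[xC xV] /=.
    have yV : y \in V j by apply: eV xV.
    rewrite inE; apply/andP; split; last exact: yV.
    apply: hC xC _; rewrite inE subUset !sub1set xV yV !andbT; exact: exy.
  have uw : connect e u w.
    rewrite -(fingraph.root_connect c_sym); move: uV wV; rewrite !inE => /eqP-> /eqP->; exact: eqxx.
  have := closed_connect ca uw; rewrite !inE uC /=.
  by move: uV; rewrite inE => -> /esym /andP[].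
- move=> j l jl; apply/pred0Pn => -[x] /=; rewrite !inE => /andP[/eqP -> /eqP/enum_val_inj jl'].
  by rewrite jl' eqxx in jl.
- have dimM j : (\max_(F in M j) #|F| = d)%N.
    apply/eqP; rewrite eqn_leq; apply/andP; split.
      by apply/bigmax_leqP => F; rewrite inE => /andP[FD _]; apply: leq_card_max.
    have [x xV] := V0 j.
    have [|H [HM _ <-]] := @facetV j [set x]; first by rewrite inE Dvertex sub1set.
    exact: leq_card_max.
  by move=> j l; rewrite /dim_complex !dimM.
apply/setP => F; apply/idP/bigcupP => [FD|[j _]]; last by rewrite inE => /andP[].
(* The empty face lies in every [M j]; [n_gt0] ensures that there is at least one [j]. *)
have [F0|[x xF]] := set_0Vmem F.
  have [j _] := idx (Ordinal n_gt0); exists j => //.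
  by rewrite inE FD F0 sub0set.
by have [j xV] := idx x; exists j => //; rewrite inE FD (cliqueV j _ x).
Qed.

End MatroidComponents.

(** * Monomials and multidegrees *)

Section Monomials.

Variables (K : fieldType) (n : nat).
Local Notation S := {mpoly K[n]}.
Local Notation "f %:F" := (FracField.tofrac f).
Implicit Types (i v x y : 'I_n) (F G H U C : {set 'I_n}) (D L : {set {set 'I_n}}).
Implicit Types (b : 'X_{1..n}) (f g : S).

Definition order_ge F (m : nat) f := forall b, f@_b != 0 -> (m <= \sum_(i in F) b i)%N.

Lemma order_geD F m f g : order_ge F m f -> order_ge F m g -> order_ge F m (f + g).
Proof.
move=> hf hg b; rewrite mcoeffD; case: (eqVneq f@_b 0) => [->|/hf //].
by rewrite add0r => /hg.
Qed.

Lemma order_geM F m1 m2 f g :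
  order_ge F m1 f -> order_ge F m2 g -> order_ge F (m1 + m2) (f * g).
Proof.
move=> hf hg b; rewrite -mcoeff_msupp => /msuppM_le/allpairsP[[b1 b2] /= [b1f b2g ->]].
rewrite !mcoeff_msupp in b1f b2g.
by under eq_bigr do rewrite mnmDE; rewrite big_split /= leq_add ?hf ?hg.
Qed.

Lemma order_ge_mull F m f g : order_ge F m g -> order_ge F m (f * g).
Proof. by move=> hg; rewrite -[m]add0n; apply: order_geM. Qed.

Lemma order_ge_sum (T : Type) (r : seq T) (P : pred T) (f : T -> S) F m :
  (forall t, P t -> order_ge F m (f t)) -> order_ge F m (\sum_(t <- r | P t) f t).
Proof.
move=> h; elim/big_rec: _ => [b|t g Pt hg]; first by rewrite mcoeff0 eqxx.
by apply: order_geD => //; apply: h.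
Qed.

Lemma order_ge_prod F m (t : 'I_m -> S) :
  (forall j, order_ge F 1 (t j)) -> order_ge F m (\prod_(j < m) t j).
Proof.
move=> h; elim: m t h => [|m IH] t h //; rewrite big_ord_recl.
exact: (order_geM (h ord0) (IH _ (fun j => h (lift ord0 j)))).
Qed.

Lemma ideal_genD (R : comNzRingType) (I : R -> Prop) (f g : R) :
  ideal_gen I f -> ideal_gen I g -> ideal_gen I (f + g).
Proof.
move=> [s [hs ->]] [t [ht ->]]; exists (s ++ t); rewrite big_cat; split=> // p.
by rewrite mem_cat => /orP[/hs|/ht].
Qed.

Lemma ideal_gen_mul (R : comNzRingType) (I : R -> Prop) (a g : R) : I g -> ideal_gen I (a * g).
Proof. by exists [:: (a, g)]; rewrite big_seq1; split=> // p; rewrite inE => /eqP ->. Qed.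

Lemma ideal_gen_sum (R : comNzRingType) (I : R -> Prop) (T : eqType) (r : seq T) (f : T -> R) :
  (forall t, t \in r -> ideal_gen I (f t)) -> ideal_gen I (\sum_(t <- r) f t).
Proof.
elim: r => [|t r IH] h; first by rewrite big_nil; exists [::]; rewrite big_nil.
rewrite big_cons; apply: ideal_genD; first by apply: h; rewrite inE eqxx.
by apply: IH => u ur; apply: h; rewrite inE ur orbT.
Qed.

(** Orders add up in products, which bounds the order on the power below by [m]. Conversely each
    monomial of order at least [m] splits off one variable of [F] at a time. *)
Lemma var_ideal_power_order F m f : ideal_power (@var_ideal K n F) m f <-> order_ge F m f.
Proof.
split=> [[s [hs ->]]|hf].
  rewrite big_seq; apply: order_ge_sum => p /hs[t [ht ->]].
  apply: order_ge_mull; apply: order_ge_prod => j.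
  have [u [hu ->]] := ht j; rewrite big_seq; apply: order_ge_sum => q /hu[i iF ->].
  apply: order_ge_mull => b.
  rewrite mcoeffX; case: (U_(i)%MM =P b) => [<- _|_]; last by rewrite eqxx.
  by rewrite (bigD1 i) //= mnm1E eqxx.
rewrite [f]mpolyE; apply: ideal_gen_sum => b; rewrite mcoeff_msupp => /hf hb.
suff [b' [t [ht ->]]] : exists b' (t : 'I_m -> 'I_n), (forall j, t j \in F) /\
    'X_[b] = 'X_[b'] * \prod_(j < m) 'X_(t j) :> S.
  rewrite scalerAl; apply: ideal_gen_mul; exists (fun j => 'X_(t j)); split=> // j.
  by rewrite -['X_ _]mul1r; apply: ideal_gen_mul; exists (t j).
elim: m b hb {hf} => [|m IH] b hb.
  by exists b, (fun j : 'I_0 => match notF (ltn_ord j) with end); rewrite big_ord0 mulr1; split=> // -[].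
have [i iF bi] : exists2 i, i \in F & (0 < b i)%N.
  case: (pickP [pred i | (i \in F) && (0 < b i)%N]) => [i /andP[]|h]; first by exists i.
  move: hb; rewrite big1 // => i iF; have := h i; rewrite /= iF /=; lia.
have Ub : (U_(i) <= b)%MM by rewrite lep1mP -lt0n.
have [|b' [t [ht eqb]]] := IH (b - U_(i))%MM.
  have : (\sum_(j in F) b j = (\sum_(j in F) (b - U_(i))%MM j).+1)%N.
    rewrite -addn1 (bigD1 i) //= [in RHS](bigD1 i) //= mnmBE mnm1E eqxx.
    rewrite (eq_bigr (fun j => (b - U_(i))%MM j)) => [|j /andP[_ /negPf ji]].
      lia.
    by rewrite mnmBE mnm1E eq_sym ji subn0.
  lia.
exists b', (fun j : 'I_m.+1 => if unlift ord0 j is Some k then t k else i); split.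
  by move=> j; case: unliftP.
rewrite big_ord_recl unlift_none (eq_bigr (fun j => 'X_(t j))) => [|j _]; last by rewrite liftK.
by rewrite mulrCA -eqb -mpolyXD addmC submK.
Qed.

Lemma symbolic_powerP D m f :
  symbolic_power D m f <-> forall H, H \in facets D -> order_ge (~: H) m f.
Proof. by split=> h H /h /var_ideal_power_order. Qed.

End Monomials.

(** * Laurent polynomials and localizations *)

Section Fractions.

Variables (K : fieldType) (n : nat).
Local Notation S := {mpoly K[n]}.
Local Notation Q := {fraction S}.
Local Notation "f %:F" := (FracField.tofrac f).
Implicit Types (i v x y : 'I_n) (F G H U C : {set 'I_n}) (D L : {set {set 'I_n}}).
Implicit Types (b : 'X_{1..n}) (f g : S) (k l m p : nat).

Definition mset F k : 'X_{1..n} := [multinom (i \in F) * k | i < n].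

Lemma monom_of_setXn F k : monom_of_set K F ^+ k = 'X_[mset F k].
Proof.
rewrite /monom_of_set mprodXE mpolyXn; congr 'X_[_]; apply/mnmP => i.
rewrite mulmnE mnm_sumE mnmE; congr muln; case: (boolP (i \in F)) => iF.
  rewrite (bigD1 i) //= mnm1E eqxx big1 // => j /andP[_ /negPf ji].
  by rewrite mnm1E ji.
by rewrite big1 // => j jF; rewrite mnm1E; case: eqP iF jF => // -> /negPf ->.
Qed.

(* Laurent polynomials, written over a common denominator. *)
Definition laurent f k : Q := f%:F / ('X_[mset setT k])%:F.

Lemma tofracX_neq0 b : ('X_[b] : S)%:F != 0 :> Q.
Proof.
rewrite tofrac_eq0; apply/eqP => /(congr1 (mcoeff b)).
by rewrite mcoeffX mcoeff0 eqxx => /eqP; rewrite oner_eq0.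
Qed.

Lemma laurentD f g k : laurent (f + g) k = laurent f k + laurent g k.
Proof. by rewrite /laurent tofracD mulrDl. Qed.

Lemma laurentB f g k : laurent (f - g) k = laurent f k - laurent g k.
Proof. by rewrite /laurent tofracB mulrBl. Qed.

Lemma laurent0 k : laurent 0 k = 0.
Proof. by rewrite /laurent tofrac0 mul0r. Qed.

Lemma laurent_sum (T : Type) (r : seq T) (P : pred T) (f : T -> S) k :
  laurent (\sum_(t <- r | P t) f t) k = \sum_(t <- r | P t) laurent (f t) k.
Proof. by apply: (big_morph (fun f => laurent f k)) => [f1 f2|]; rewrite ?laurentD ?laurent0. Qed.

Lemma laurentZ a f k : laurent (a *: f) k = (a%:MP_[n])%:F * laurent f k.
Proof. by rewrite /laurent -mul_mpolyC tofracM mulrA. Qed.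

Lemma msetD F k l : mset F (k + l) = (mset F k + mset F l)%MM.
Proof. by apply/mnmP => i; rewrite mnmDE !mnmE mulnDr. Qed.

Lemma laurent_raise f k l : laurent f k = laurent (f * 'X_[mset setT l]) (k + l).
Proof.
rewrite /laurent msetD mpolyXD !tofracM -mulf_div divff ?mulr1 //.
exact: tofracX_neq0.
Qed.

Lemma localized_laurent I F (q : Q) : localized I F q -> exists k g, q = laurent g k.
Proof.
move=> [f [k [_ ->]]]; exists k, (f * 'X_[mset (~: F) k]).
have eT : mset setT k = (mset F k + mset (~: F) k)%MM.
  by apply/mnmP => i; rewrite mnmDE !mnmE !inE; case: (i \in F); rewrite /= ?addn0.
rewrite /laurent eT monom_of_setXn mpolyXD !tofracM -mulf_div divff ?mulr1 //.
exact: tofracX_neq0.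
Qed.

Lemma mcoeffMX_neq0 f b b' : (f * 'X_[b'])@_b != 0 -> exists2 c, f@_c != 0 & b = (c + b')%MM.
Proof.
rewrite -mcoeff_msupp => /msuppM_le/allpairsP[[c c'] /= [cf]].
by rewrite msuppX inE => /eqP -> ->; exists c; rewrite -?mcoeff_msupp.
Qed.

(* The monomial x^b / (x_1 ... x_n)^k has multidegree a = b - k (1, ..., 1);
   [neg k b] is the set of i with a_i < 0 and [pos k b] the positive part of a. *)
Definition neg k b := [set i | (b i < k)%N].
Definition pos k b i := (b i - k)%N.

Lemma neg_subP k b F : reflect (forall i, i \notin F -> (k <= b i)%N) (neg k b \subset F).
Proof.
apply: (iffP subsetP) => h i; last first.
  by rewrite inE; apply: contraTT => /h; rewrite -leqNgt.
by rewrite leqNgt; apply: contraNN => bi; apply: h; rewrite inE.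
Qed.

(** Membership is decided monomial by monomial. Exponents on [F] can be raised at will in [S_(x_F)],
    so only the facets containing [F] impose a condition, and only through exponents off [F]. *)
Lemma localizedP D m F g k :
  localized (@symbolic_power K n D m) F (laurent g k) <->
  forall b, g@_b != 0 -> neg k b \subset F /\ F \notin degree_family D m (neg k b) (pos k b).
Proof.
split=> [[f [l [/symbolic_powerP fI /eqP eqfg]]] b gb|h].
  move: eqfg; rewrite monom_of_setXn eqr_div ?tofracX_neq0 // -!tofracM tofrac_eq => /eqP eqfg.
  have [|c fc eqb] := @mcoeffMX_neq0 f (b + mset F l)%MM (mset setT k).
    by rewrite -eqfg addmC mcoeffMX.
  have bi i : i \notin F -> b i = (c i + k)%N.
    move=> iF; have := congr1 (fun b : 'X_{1..n} => b i) eqb.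
    by rewrite !mnmDE !mnmE (negPf iF) inE mul0n addn0 mul1n.
  have nF : neg k b \subset F by apply/neg_subP => i /bi ->; rewrite leq_addl.
  split=> //; apply/degree_familyP => -[_ [H [HD FH]]]; rewrite ltnNge => /negP; apply.
  apply: leq_trans (fI H HD c fc) _; apply: leq_sum => i; rewrite inE => iH.
  by rewrite /pos bi ?addnK // (contraNN (subsetP FH i)).
(* Multiplying by [x_F ^ (k + m)] clears the denominator on [F] and leaves exponents at least [m]
   there, which settles every facet not containing [F]. *)
pose l := (k + m)%N.
pose f := \sum_(b <- msupp g) g@_b *: 'X_[b + mset F l - mset setT k] : S.
exists f, l; split.
  apply/symbolic_powerP => H HD; rewrite /f big_seq; apply: order_ge_sum => b.
  rewrite mcoeff_msupp => /h[/neg_subP nF FL] b'; rewrite mcoeffZ mcoeffX.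
  case: (_ =P b') => [<- _|_]; last by rewrite mulr0 eqxx.
  case: (boolP (F \subset H)) => FH.
    rewrite leqNgt; apply: contraNN FL => Hm; apply/degree_familyP; split; first exact/neg_subP.
    exists H; split=> //; apply: leq_ltn_trans Hm; apply: leq_sum => i; rewrite inE => iH.
    have iF : i \notin F by apply: contraNN iH; apply: subsetP.
    by rewrite /pos mnmBE mnmDE !mnmE inE (negPf iF) addn0 mul1n.
  have [i iF iH] := subsetPn FH.
  rewrite (bigD1 i) ?inE //= mnmBE mnmDE !mnmE inE iF !mul1n /l.
  by apply: leq_trans (leq_addr _ _); move: (b i); clear; lia.
apply/eqP; rewrite monom_of_setXn eqr_div ?tofracX_neq0 // -!tofracM tofrac_eq.
apply/eqP; rewrite {1}[g]mpolyE /f !mulr_suml; apply: eq_big_seq => b.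
rewrite mcoeff_msupp => /h[/neg_subP nF _]; rewrite -!scalerAl -!mpolyXD; congr (_ *: 'X_[_]).
rewrite submK //; apply/mnm_lepP => i; rewrite mnmDE !mnmE inE mul1n.
by case: (boolP (i \in F)) => [_|/nF bk]; rewrite /l; lia.
Qed.

(** The empty complex with exponent 0 has the whole ring as symbolic power, so [localizedP]
    applies. *)
Lemma localized_unitP F g k :
  localized (@unit_ideal K n) F (laurent g k) <-> forall b, g@_b != 0 -> neg k b \subset F.
Proof.
have -> : localized (@unit_ideal K n) F (laurent g k) <->
          localized (@symbolic_power K n set0 0) F (laurent g k).
  split=> -[f [l [_ ->]]]; exists f, l; split=> //.
  by apply/symbolic_powerP => H _ b _; rewrite leq0n.
rewrite localizedP; split=> h b /h; first by case.
by move=> nF; split=> //; apply/degree_familyP => -[_ [H []]].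
Qed.

(** Finitely many components have a common denominator; all larger exponents are allowed so that
    several cochains can share one. *)
Lemma cech_cochain_laurent p (c : {set 'I_n} -> Q) : cech_cochain p c ->
  exists k0, forall k, (k0 <= k)%N -> exists g : {set 'I_n} -> S,
    (forall F, #|F| = p -> c F = laurent (g F) k) /\ (forall F, #|F| != p -> g F = 0).
Proof.
move=> hc.
have /fin_all_exists[k0 /fin_all_exists[g hg]] F : exists k0 g, #|F| = p -> c F = laurent g k0.
  case: (#|F| =P p) => [Fp|]; last by exists 0%N, 0.
  by have [k [g gE]] := localized_laurent (hc F Fp); exists k, g.
exists (\max_F k0 F)%N => k hk.
exists (fun F => if #|F| == p then g F * 'X_[mset setT (k - k0 F)] else 0).
split=> F; last by move/negPf ->.
move=> Fp; rewrite Fp eqxx hg // (laurent_raise _ _ (k - k0 F)) subnKC //.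
by apply: leq_trans hk; apply: (leq_bigmax F).
Qed.

Lemma cech_diff_laurent (c : {set 'I_n} -> Q) (g : {set 'I_n} -> S) k F :
  (forall i, i \in F -> c (F :\ i) = laurent (g (F :\ i)) k) ->
  cech_diff c F = laurent (coboundary g F) k.
Proof.
move=> h; rewrite /coboundary laurent_sum; apply: eq_bigr => i /h ->.
by rewrite /laurent tofracM mulrA; congr (_ * _ / _); rewrite /inc_sign tofracXn tofracN tofrac1.
Qed.

Lemma mcoeff_coboundary (g : {set 'I_n} -> S) F b :
  (coboundary g F)@_b = coboundary (fun F => (g F)@_b) F.
Proof.
rewrite /coboundary raddf_sum /=; apply: eq_bigr => i _.
by rewrite /inc_sign -signr_odd -[in RHS]signr_odd !mulr_sign; case: (odd _); rewrite ?mcoeffN.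
Qed.

(** Admissible facets contain [G], so weights are only summed outside [G]. This yields the
    invariance under shifts along [G]. *)
Lemma eq_degree_family D m G (w w' : 'I_n -> nat) :
  (forall i, i \notin G -> w i = w' i) -> degree_family D m G w = degree_family D m G w'.
Proof.
move=> ww'; apply/setP => F; rewrite !inE; case: (boolP (G \subset F)) => //= GF.
apply: eq_existsb => H; case: (boolP (F \subset H)) => //= FH; congr (_ && (_ < _)%N).
apply: eq_bigr => i; rewrite inE => iH; apply: ww'; apply: contraNN iH => iG.
by rewrite (subsetP FH) ?(subsetP GF).
Qed.

End Fractions.

(** * Local cohomology by degree *)

Section LocalCohomologyByDegree.

Variables (K : fieldType) (n : nat) (D : {set {set 'I_n}}) (m : nat).
Local Notation S := {mpoly K[n]}.
Local Notation Q := {fraction S}.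
Local Notation "f %:F" := (FracField.tofrac f).
Implicit Types (i v x y : 'I_n) (F G H U C : {set 'I_n}).
Implicit Types (b : 'X_{1..n}) (f g : S) (k l p : nat).

Local Notation I := (@symbolic_power K n D m).
Local Notation L k b := (degree_family D m (neg k b) (pos k b)).

(** The upper condition on members passes to subsets, so only the lower bound [G] can fail. Hence a
    cochain vanishing on sets that do not contain [G] can be restricted to the family without
    changing its coboundary there. *)
Lemma degree_family_down G w F i :
  F \in degree_family D m G w -> F :\ i \notin degree_family D m G w -> ~~ (G \subset F :\ i).
Proof.
move=> /degree_familyP[_ [H [HD FH Hm]]]; apply: contraNN => GF.
by apply/degree_familyP; split=> //; exists H; split=> //; apply: subset_trans FH; apply: subsetDl.
Qed.

Lemma cocycle_degree p (c : {set 'I_n} -> Q) (g : {set 'I_n} -> S) k b :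
  cech_cocycle I p c -> (forall F, #|F| = p -> c F = laurent (g F) k) ->
  forall F, F \in L k b -> #|F| = p.+1 -> coboundary (fun F => (g F)@_b) F = 0.
Proof.
move=> [_ hc] cg F FL Fp; have := hc F Fp.
rewrite (@cech_diff_laurent _ _ _ g k); last first.
  by move=> i iF; apply: cg; move: Fp; rewrite (cardsD1 i) iF => -[].
move=> /localizedP/(_ b); rewrite mcoeff_coboundary => h.
by apply/eqP/negPn/negP => /h[_]; rewrite FL.
Qed.

Lemma cochain_degree p (c : {set 'I_n} -> Q) (g : {set 'I_n} -> S) k b F :
  cech_cochain p c -> (forall F, #|F| = p -> c F = laurent (g F) k) ->
  #|F| = p -> ~~ (neg k b \subset F) -> (g F)@_b = 0.
Proof.
move=> hc cg Fp nF; have := hc F Fp; rewrite cg // => /localized_unitP h.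
by apply/eqP/negPn/negP => /h; rewrite (negPf nF).
Qed.

Lemma restrict_coboundary (c : {set 'I_n} -> K) G w F :
  (forall F, ~~ (G \subset F) -> c F = 0) -> F \in degree_family D m G w ->
  coboundary (fun F => if F \in degree_family D m G w then c F else 0) F = coboundary c F.
Proof.
move=> c0 FL; apply: eq_coboundary => i iF; case: ifPn => // nF.
by rewrite c0 // (degree_family_down FL).
Qed.

Lemma seq_all_exists (T : eqType) (U : Type) (u0 : U) (P : T -> U -> Prop) (s : seq T) :
  (forall t, t \in s -> exists u, P t u) -> exists u, forall t, t \in s -> P t (u t).
Proof.
elim: s => [|t s IH] h; first by exists (fun=> u0).
have [|u hu] := IH; first by move=> t' t's; apply: h; rewrite inE t's orbT.
have [ut ht] := h t (mem_head t s).
exists (fun t' => if t' == t then ut else u t') => t'; rewrite inE.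
by case: eqP => [-> //|_] /=; apply: hu.
Qed.

Lemma degree_coboundary p (c : {set 'I_n} -> K) k b :
  acyclic K (L k b) p ->
  (forall F, ~~ (neg k b \subset F) -> c F = 0) ->
  (forall F, F \in L k b -> #|F| = p.+1 -> coboundary c F = 0) ->
  exists2 e, supported (L k b) e & forall F, F \in L k b -> #|F| = p -> c F = coboundary e F.
Proof.
move=> acL c0 cc.
have [|F FL Fp|e es eE] := acL (fun F => if F \in L k b then c F else 0).
- by move=> F /negPf ->.
- by rewrite restrict_coboundary ?cc.
by exists e => // F FL Fp; rewrite -eE // FL.
Qed.

(* In degree a >= 0 with all a_i < m, the cocycles are a kernel. *)
Let N := #|{: {set 'I_n}}|.
Let box := {ffun 'I_n -> 'I_m}.
Let mnm_box (a : box) : 'X_{1..n} := [multinom (a i : nat) | i < n].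
Let Lbox (a : box) := degree_family D m set0 (fun i => a i : nat).
Let cochain_of (z : 'rV[K]_N) F := z 0 (enum_rank F).
(** Columns of sets outside the family or of the wrong size are zero, so that the left kernel
    imposes the cocycle condition exactly where it is required. *)
Let diff_mx p (a : box) : 'M[K]_N := \matrix_(r, s)
  if (enum_val s \in Lbox a) && (#|enum_val s| == p.+1)
  then coboundary (fun F => (F == enum_val r)%:R) (enum_val s) else 0.

Let diff_mxE p a z : reflect
  (forall F, F \in Lbox a -> #|F| = p.+1 -> coboundary (cochain_of z) F = 0)
  (z *m diff_mx p a == 0).
Proof.
have zE s : (z *m diff_mx p a) 0 s =
   if (enum_val s \in Lbox a) && (#|enum_val s| == p.+1)
   then coboundary (cochain_of z) (enum_val s) else 0.
  rewrite mxE; under eq_bigr do rewrite mxE.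
  case: ifP => _; last by rewrite big1 // => r _; rewrite mulr0.
  rewrite /coboundary; under eq_bigr do rewrite mulr_sumr.
  rewrite exchange_big; apply: eq_bigr => i _ /=; under eq_bigr do rewrite mulrCA.
  rewrite -mulr_sumr; congr (_ * _); rewrite (bigD1 (enum_rank (enum_val s :\ i))) //=.
  rewrite enum_rankK eqxx mulr1 big1 ?addr0 // => r ri.
  by case: eqP => [eqr|]; rewrite ?mulr0 //; rewrite eqr enum_valK eqxx in ri.
apply: (iffP eqP) => [z0 F FL Fp|h].
  by have := zE (enum_rank F); rewrite z0 mxE enum_rankK FL Fp eqxx.
apply/rowP => s; rewrite zE mxE; case: ifP => // /andP[sL /eqP sp]; exact: h.
Qed.

Let neg0 b : neg 0 b = set0.
Proof. by apply/setP => i; rewrite !inE. Qed.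

Let neg_box k a : neg k (mnm_box a + mset setT k)%MM = set0.
Proof. by apply/setP => i; rewrite !inE mnmDE !mnmE inE mul1n ltnNge leq_addl. Qed.

Let Lbox_E k a : L k (mnm_box a + mset setT k)%MM = Lbox a.
Proof.
rewrite neg_box; apply: eq_degree_family => i _.
by rewrite /pos mnmDE !mnmE inE mul1n addnK.
Qed.

(** Cocycles are treated degree by degree: a negative coordinate gives a primitive by hypothesis,
    otherwise some a_i >= m gives one by the cone argument, and the finitely many remaining degrees
    are spanned by kernel rows. *)
Lemma fin_dim_of_acyclic p :
  (forall G w, G != set0 -> acyclic K (degree_family D m G w) p) ->
  fin_dim_local_cohomology I p.
Proof.
move=> ac.
pose T : finType := (box * 'I_N)%type.
(* One generator for each degree in the box and each row of its kernel matrix, concentrated in that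
   degree. *)
pose e (t : T) F : S := kermx (diff_mx p t.1) t.2 (enum_rank F) *: 'X_[mnm_box t.1].
exists #|T|, (fun j F => laurent (e (enum_val j) F) 0); split.
  move=> j; set t := enum_val j.
  have eb F b : (e t F)@_b != 0 -> b = mnm_box t.1.
    by rewrite mcoeffZ mcoeffX; case: (mnm_box t.1 =P b) => [->|_]; rewrite ?mulr0 ?eqxx.
  split=> F Fp; first by apply/localized_unitP => b _; rewrite neg0 sub0set.
  rewrite (@cech_diff_laurent _ _ _ (e t) 0) //; apply/localizedP => b cb.
  rewrite neg0 sub0set; split=> //.
  have {}cb : coboundary (fun F => (e t F)@_b) F != 0 by rewrite -mcoeff_coboundary.
  have ebt : b = mnm_box t.1.
    apply/eqP; apply: contraNT cb => nb; apply/eqP; apply: coboundary0 => i _.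
    by apply/eqP; apply: contraNT nb => /eb ->.
  have := row_sub t.2 (kermx (diff_mx p t.1)); move/sub_kermxP/eqP/diff_mxE => h.
  have -> : degree_family D m set0 (pos 0 b) = Lbox t.1.
    by apply: eq_degree_family => i _; rewrite /pos subn0 ebt mnmE.
  apply: contraNN cb => FL; apply/eqP; rewrite -[RHS](h F FL Fp); apply: eq_coboundary => i _.
  by rewrite /cochain_of mxE mcoeffZ mcoeffX ebt eqxx mulr1.
move=> c cc; have [hc _] := cc.
have [k /(_ k (leqnn k))[g [cg g0]]] := cech_cochain_laurent hc.
pose lam b F := (g F)@_b.
have lam0 b F : ~~ (neg k b \subset F) -> lam b F = 0.
  move=> nF; case: (#|F| =P p) => [Fp|/eqP Fp]; last by rewrite /lam g0 ?mcoeff0.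
  exact: cochain_degree cg Fp nF.
have lamC b := cocycle_degree cc cg (b := b).
(* Over the denominator with exponent [k], these are the box degrees 0 <= a_i < m. *)
pose good b := [forall i, (k <= b i < k + m)%N].
pose Bs := undup (flatten [seq msupp (g F) | F <- enum {: {set 'I_n}}]).
have BsP b F : lam b F != 0 -> b \in Bs.
  move=> h; rewrite mem_undup; apply/flatten_mapP; exists F; first by rewrite mem_enum.
  by rewrite mcoeff_msupp.
(* In box degrees the generators absorb the whole component, so the primitive is 0 there. *)
pose good_filler b (u : {set 'I_n} -> K) := supported (L k b) u /\
  if good b then forall F, u F = 0
  else forall F, F \in L k b -> #|F| = p -> lam b F = coboundary u F.
have [mu hmu] : exists mu, forall b, b \in Bs -> good_filler b (mu b).
  apply: seq_all_exists => [|b _]; first exact: (fun=> 0).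
  case: (boolP (good b)) => gb; first by exists (fun=> 0); rewrite /good_filler gb.
  suff acb : acyclic K (L k b) p.
    by have [u us uE] := degree_coboundary acb (lam0 b) (lamC b); exists u; rewrite /good_filler (negPf gb).
  case: (eqVneq (neg k b) set0) => [n0|]; last exact: ac.
  have [i bi] := forallPn gb; apply: (@acyclic_degree_family_big _ _ _ _ _ _ i).
    by rewrite n0 inE.
  have : i \notin neg k b by rewrite n0 inE.
  by rewrite inE -leqNgt => kb; move: bi; rewrite kb -leqNgt /pos => h; rewrite leq_subRL.
pose lamv b : 'rV[K]_N := \row_r lam b (enum_val r).
have /fin_all_exists[u uE] (a : box) : exists u : 'rV[K]_N,
    lamv (mnm_box a + mset setT k)%MM = u *m kermx (diff_mx p a).
  apply/submxP/sub_kermxP/eqP/diff_mxE => F FL Fp.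
  rewrite -[RHS](lamC (mnm_box a + mset setT k)%MM F) ?Lbox_E //.
  by apply: eq_coboundary => i _; rewrite /cochain_of mxE enum_rankK.
exists (fun j => u (enum_val j).1 0 (enum_val j).2).
pose B F := \sum_(b <- Bs) mu b F *: 'X_[b] : S.
have BE F b : (B F)@_b = if b \in Bs then mu b F else 0.
  rewrite /B raddf_sum /=; under eq_bigr do rewrite mcoeffZ mcoeffX.
  case: ifPn => bB; last first.
    rewrite big_seq big1 // => b' b'B; case: eqP => [eqb|]; rewrite ?mulr0 //.
    by rewrite -eqb b'B in bB.
  rewrite (bigD1_seq b) ?undup_uniq //= eqxx mulr1 big1 ?addr0 // => b' /negPf ->.
  by rewrite mulr0.
exists (fun F => laurent (B F) k); split.
  move=> q _ F _; apply/localized_unitP => b; rewrite BE; case: ifPn => [/hmu[us _]|]; last by rewrite eqxx.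
  by case: (boolP (F \in L k b)) => [/degree_familyP[]|/us -> /[!eqxx]].
move=> F Fp.
(* The combination of generators over the denominator of [c]; [EE] identifies it with the box part
   of [c]. *)
pose E F : S := \sum_(a : box) \sum_(r < N)
   (u a 0 r * kermx (diff_mx p a) r (enum_rank F)) *: 'X_[mnm_box a + mset setT k].
have -> : c F - \sum_(j < #|T|) (((u (enum_val j).1 0 (enum_val j).2)%:MP_[n])%:F * laurent (e (enum_val j) F) 0)
   - cech_diff (fun F => laurent (B F) k) F = laurent (g F - E F - coboundary B F) k.
  rewrite (@cech_diff_laurent _ _ _ B k) // cg // !laurentB; congr (_ - _ - _).
  rewrite -(big_enum_val (A := predT) (fun t : T => (((u t.1 0 t.2)%:MP_[n])%:F * laurent (e t F) 0))).
  rewrite /E pair_bigA /= laurent_sum; apply: eq_bigr => -[a r] _ /=.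
  by rewrite -laurentZ (laurent_raise _ 0 k) add0n /e -scalerAl -scalerAl -mpolyXD scalerA.
apply/localizedP => b.
have EE : (E F)@_b = if good b then lam b F else 0.
  rewrite /E raddf_sum /=.
  have inner (a : box) : (\sum_(r < N) (u a 0 r * kermx (diff_mx p a) r (enum_rank F)) *: 'X_[mnm_box a + mset setT k])@_b
     = if (mnm_box a + mset setT k)%MM == b then lam b F else 0.
    rewrite raddf_sum /=; under eq_bigr do rewrite mcoeffZ mcoeffX.
    case: eqP => [eb|_]; last by rewrite big1 // => r _; rewrite mulr0.
    have := congr1 (fun z : 'rV[K]_N => z 0 (enum_rank F)) (uE a).
    by rewrite !mxE enum_rankK eb => ->; apply: eq_bigr => r _; rewrite mulr1.
  under eq_bigr do rewrite inner.
  case: ifPn => gb; last first.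
    rewrite big1 // => a _; case: eqP => // eb; case/negP: gb; apply/forallP => i.
    by rewrite -eb mnmDE !mnmE inE mul1n leq_addl addnC ltn_add2l ltn_ord.
  have ltb i : (b i - k < m)%N by have /andP[h1 h2] := forallP gb i; rewrite ltn_subLR.
  pose a0 : box := [ffun i => Ordinal (ltb i)].
  have ea0 : (mnm_box a0 + mset setT k)%MM = b.
    apply/mnmP => i; rewrite mnmDE !mnmE inE mul1n ffunE /= subnK //.
    by have /andP[] := forallP gb i.
  rewrite (bigD1 a0) //= ea0 eqxx big1 ?addr0 // => a na; case: eqP => // ea.
  case/negP: na; apply/eqP/ffunP => i; apply: val_inj => /=.
  have := congr1 (fun b : 'X_{1..n} => b i) (etrans ea (esym ea0)).
  by rewrite !mnmDE !mnmE => /addIn.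
rewrite !mcoeffB EE mcoeff_coboundary -/(lam b F).
have CE : coboundary (fun F => (B F)@_b) F = if b \in Bs then coboundary (mu b) F else 0.
  case: ifPn => bB; first by apply: eq_coboundary => i _; rewrite BE bB.
  by apply: coboundary0 => i _; rewrite BE (negPf bB).
rewrite CE; case: ifPn => gb.
  rewrite subrr sub0r oppr_eq0; case: ifPn => [/hmu[_]|]; last by rewrite eqxx.
  by rewrite gb => mu0; rewrite coboundary0 ?eqxx // => i _; rewrite mu0.
rewrite subr0; case: ifPn => bB; last first.
  by rewrite subr0 => /BsP; rewrite (negPf bB).
have [us] := hmu b bB; rewrite (negPf gb) => hE nz.
have nF : neg k b \subset F.
  apply: contraNT nz => nF; rewrite lam0 // sub0r oppr_eq0; apply/eqP.
  apply: coboundary0 => i iF; apply: us; apply: contraNN nF => /degree_familyP[h _].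
  by apply: subset_trans h (subsetDl _ _).
split=> //; apply: contraNN nz => FL; by rewrite hE // subrr.
Qed.

End LocalCohomologyByDegree.

(** * Finite dimension forces vanishing *)

Section LocalCohomologyConverse.

Variables (K : fieldType) (n : nat) (D : {set {set 'I_n}}) (m : nat).
Local Notation S := {mpoly K[n]}.
Local Notation Q := {fraction S}.
Local Notation "f %:F" := (FracField.tofrac f).
Implicit Types (i v x y : 'I_n) (F G H U C : {set 'I_n}).
Implicit Types (b : 'X_{1..n}) (f g : S) (k l p : nat).

Local Notation I := (@symbolic_power K n D m).

Lemma localized0 F : localized I F 0.
Proof.
exists 0, 0%N; rewrite tofrac0 mul0r; split=> //.
by apply/symbolic_powerP => H _ b; rewrite mcoeff0 eqxx.
Qed.

Lemma localizedD F q1 q2 : localized I F q1 -> localized I F q2 -> localized I F (q1 + q2).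
Proof.
move=> [f1 [k1 [/symbolic_powerP h1 ->]]] [f2 [k2 [/symbolic_powerP h2 ->]]].
exists (f1 * monom_of_set K F ^+ k2 + f2 * monom_of_set K F ^+ k1), (k1 + k2)%N; split.
  apply/symbolic_powerP => H HD; rewrite mulrC (mulrC f2).
  by apply: order_geD; apply: order_ge_mull; [apply: h1|apply: h2].
rewrite exprD !monom_of_setXn tofracD !tofracM addf_div ?tofracX_neq0 //.
Qed.

Lemma localizedZ F (a : K) q : localized I F q -> localized I F ((a%:MP_[n])%:F * q).
Proof.
move=> [f [k [/symbolic_powerP h ->]]]; exists (a%:MP_[n] * f), k; split.
  by apply/symbolic_powerP => H HD; apply: order_ge_mull; apply: h.
by rewrite tofracM mulrA.
Qed.

(* Shifting a degree a along G = {i | a_i < 0} does not change the degree-a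
   complex, so a non-trivial class gives infinitely many independent ones. *)
Lemma acyclic_of_fin_dim p : fin_dim_local_cohomology I p ->
  forall G w, G != set0 -> acyclic K (degree_family D m G w) p.
Proof.
move=> [N [e [ec espan]]] G w GN0 c cs cc.
set L := degree_family D m G w in cs cc *.
have Lgt0 F : F \in L -> (0 < #|F|)%N.
  move=> /degree_familyP[GF _]; rewrite (leq_trans _ (subset_leq_card GF)) //.
  by rewrite card_gt0.
(* In degree 0 nothing is to be shown: members contain the nonempty [G]. *)
case: p => [|p] in espan ec cc *.
  by exists (fun=> 0) => // F /Lgt0 /[swap] ->.
(* There are [N.+1] shifts against [N] generators. Shift [t] has a_i = -(t + 1) on [G] and a_i = w i
   elsewhere, so [k] also serves as the denominator exponent. *)
pose k := N.+1.
pose bt (t : 'I_k) : 'X_{1..n} := [multinom (if i \in G then k - t.+1 else k + w i)%N | i < n].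
have bt_neg (t : 'I_k) l : neg (k + l) (bt t + mset setT l)%MM = G.
  apply/setP => i; rewrite inE mnmDE !mnmE inE mul1n ltn_add2r.
  by case: (i \in G); [rewrite ltn_subrL | rewrite ltnNge leq_addr].
have bt_L t l : degree_family D m G (pos (k + l) (bt t + mset setT l)%MM) = L.
  apply: eq_degree_family => i iG; rewrite /pos mnmDE !mnmE (negPf iG) inE mul1n.
  by rewrite subnDr addKn.
have bt_inj : injective bt.
  move=> s t st; have [i iG] := set0Pn _ GN0.
  have := congr1 (fun b : 'X_{1..n} => b i) st; rewrite !mnmE iG => h.
  by apply: val_inj; move: h (ltn_ord s) (ltn_ord t) => /=; rewrite /k; clear; lia.
pose ct t F := laurent (c F *: 'X_[bt t] : S) k.
have ct_cocycle t : cech_cocycle I p.+1 (ct t).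
  split=> F Fp.
    apply/localized_unitP => b; rewrite mcoeffZ mcoeffX.
    case: (bt t =P b) => [<-|_]; last by rewrite mulr0 eqxx.
    have := bt_neg t 0; rewrite addn0 (_ : mset _ 0 = 0%MM) ?addm0 => [->|]; last first.
      by apply/mnmP => i; rewrite !mnmE muln0.
    by rewrite mulr1; case: (boolP (F \in L)) => [/degree_familyP[]|/cs -> /[!eqxx]].
  rewrite (@cech_diff_laurent _ _ _ (fun F => c F *: 'X_[bt t]) k) //.
  apply/localizedP => b; rewrite mcoeff_coboundary.
  have -> : coboundary (fun F => (c F *: 'X_[bt t] : S)@_b) F = coboundary c F * (bt t == b)%:R.
    by rewrite mulr_suml; apply: eq_bigr => i _; rewrite mcoeffZ mcoeffX mulrA.
  case: (bt t =P b) => [<-|_]; last by rewrite mulr0 eqxx.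
  rewrite mulr1 => nz.
  have := bt_neg t 0; have := bt_L t 0; rewrite addn0 (_ : mset _ 0 = 0%MM) ?addm0; last first.
    by apply/mnmP => i; rewrite !mnmE muln0.
  move=> hL hG; rewrite hG hL; split; last by apply: contraNN nz => FL; rewrite cc.
  apply: contraNT nz => nG; apply/eqP; apply: coboundary0 => i iF; apply: cs.
  by apply: contraNN nG => /degree_familyP[h _]; apply: subset_trans h (subsetDl _ _).
have /fin_all_exists[a /fin_all_exists[B hB]] t :
    exists a B, (forall q, q.+1 = p.+1 -> cech_cochain q B) /\ forall F, #|F| = p.+1 ->
      localized I F (ct t F - \sum_(j < N) ((a j)%:MP_[n])%:F * e j F - cech_diff B F).
  by have [a [B hB]] := espan _ (ct_cocycle t); exists a, B.
(* With more rows than columns, a nonzero combination [z] of the shifted cocycles cancels all [e j]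
   and is therefore a coboundary. *)
pose A : 'M[K]_(k, N) := \matrix_(t, j) a t j.
have [z zA zN0] : exists2 z : 'rV[K]_k, z *m A = 0 & z != 0.
  have : kermx A != 0.
    rewrite -mxrank_eq0 mxrank_ker -lt0n subn_gt0.
    by apply: leq_ltn_trans (rank_leq_col A) _.
  by case/rowV0Pn => z /sub_kermxP; exists z.
have [t0 zt0] : exists t, z 0 t != 0.
  apply/existsP; apply: contraNT zN0 => /existsPn h; apply/eqP/rowP => t.
  by rewrite mxE; apply/eqP/negPn/h.
have hBk t : exists k0, forall k, (k0 <= k)%N -> exists g : {set 'I_n} -> S,
    (forall F, #|F| = p -> B t F = laurent (g F) k) /\ (forall F, #|F| != p -> g F = 0).
  by apply: cech_cochain_laurent; have [h _] := hB t; apply: h.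
have /fin_all_exists[k0 hk0] := hBk.
pose l := (\max_t k0 t)%N.
have /fin_all_exists[g hg] t : exists g : {set 'I_n} -> S,
    (forall F, #|F| = p -> B t F = laurent (g F) (k + l)) /\ (forall F, #|F| != p -> g F = 0).
  by apply: hk0; apply: leq_trans (leq_addl _ _); apply: (leq_bigmax t).
pose gz F : S := \sum_t z 0 t *: g t F.
pose cz F : S := \sum_t (z 0 t * c F) *: 'X_[bt t + mset setT l].
have loc F : #|F| = p.+1 -> localized I F (laurent (cz F - coboundary gz F) (k + l)).
  move=> Fp.
  pose x t := ct t F - \sum_(j < N) ((a t j)%:MP_[n])%:F * e j F - cech_diff (B t) F.
  have -> : laurent (cz F - coboundary gz F) (k + l) = \sum_t ((z 0 t)%:MP_[n])%:F * x t.
    have xE t : x t = laurent (c F *: 'X_[bt t + mset setT l] - coboundary (g t) F) (k + l)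
        - \sum_(j < N) ((a t j)%:MP_[n])%:F * e j F.
      rewrite /x addrAC; congr (_ - _); rewrite laurentB; congr (_ - _).
        by rewrite /ct (laurent_raise _ _ l) -scalerAl -mpolyXD.
      apply: cech_diff_laurent => i iF; have [-> //] := hg t.
      by move: Fp; rewrite (cardsD1 i) iF => -[].
    under [RHS]eq_bigr do rewrite xE mulrBr -laurentZ.
    rewrite sumrB -laurent_sum [X in _ = _ - X](_ : _ = 0) ?subr0.
      congr (laurent _ _); under [RHS]eq_bigr do rewrite scalerBr scalerA.
      rewrite sumrB; congr (_ - _); rewrite /coboundary.
      under [RHS]eq_bigr do rewrite scaler_sumr.
      rewrite exchange_big; apply: eq_bigr => i _ /=; rewrite /gz mulr_sumr.
      by apply: eq_bigr => t _; rewrite scalerAr.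
    under eq_bigr do rewrite mulr_sumr; rewrite exchange_big big1 //= => j _.
    have := congr1 (fun v : 'rV[K]_N => v 0 j) zA; rewrite !mxE => zAj.
    under eq_bigr do rewrite mulrA -tofracM -mpolyCM.
    rewrite -mulr_suml -rmorph_sum /= -rmorph_sum /=.
    rewrite [X in (X%:MP_[n])%:F](_ : _ = 0) ?mpolyC0 ?tofrac0 ?mul0r //.
    by rewrite -[RHS]zAj; apply: eq_bigr => t _; rewrite mxE.
  apply: (big_ind (localized I F)); [exact: localized0|by move=> q1 q2; apply: localizedD|].
  by move=> t _; apply: localizedZ; have [_ h] := hB t; apply: h.
(* Reading that relation in the degree of one shift [t0] with nonzero coefficient isolates [c] up to
   a scalar. *)
pose b0 := (bt t0 + mset setT l)%MM.
pose u F := if F \in L then (z 0 t0)^-1 * (gz F)@_b0 else 0.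
exists u => [F /negPf FL|F FL Fp]; first by rewrite /u FL.
have gz0 F' : #|F'| = p -> ~~ (G \subset F') -> (gz F')@_b0 = 0.
  move=> Fp' nG; rewrite /gz raddf_sum big1 //= => t _; rewrite mcoeffZ.
  have [h _] := hB t; have := h p erefl F' Fp'; have [-> // _] := hg t.
  move=> /localized_unitP/(_ b0); rewrite bt_neg (negPf nG) => h'.
  by apply/eqP; rewrite mulf_eq0; apply/orP; right; apply/negPn/negP => /h'.
have cz0 : (cz F)@_b0 = z 0 t0 * c F.
  rewrite /cz raddf_sum /= (bigD1 t0) //= mcoeffZ mcoeffX eqxx mulr1 big1 ?addr0 // => t tt0.
  rewrite mcoeffZ mcoeffX; case: eqP => [/addIm/bt_inj ett|]; last by rewrite mulr0.
  by rewrite ett eqxx in tt0.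
have := loc F Fp => /localizedP/(_ b0); rewrite mcoeffB cz0 mcoeff_coboundary bt_neg bt_L FL => h.
have {h} : z 0 t0 * c F = coboundary (fun F => (gz F)@_b0) F.
  by apply/eqP; rewrite -subr_eq0; apply/negPn/negP => /h[].
move/(congr1 ( *%R (z 0 t0)^-1)); rewrite mulKf // => ->; rewrite -coboundaryZ.
apply: eq_coboundary => i iF; rewrite /u; case: ifPn => // nL.
rewrite gz0 ?mulr0 //; first by move: Fp; rewrite (cardsD1 i) iF => -[].
exact: degree_family_down FL nL.
Qed.

End LocalCohomologyConverse.

(** * Krull dimension *)

Section PrimeChains.

Variable R : comNzRingType.
Implicit Types (P : {pred R}) (f g : R).

Lemma ideal_sum P (T : Type) (r : seq T) (Q : pred T) (f : T -> R) :
  idealr_closed P -> (forall t, Q t -> f t \in P) -> \sum_(t <- r | Q t) f t \in P.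
Proof.
move=> [P0 _ PD] h; elim/big_rec: _ => // t g Qt gP.
by rewrite -[f t]mul1r PD // h.
Qed.

Lemma ideal_mull P f g : idealr_closed P -> g \in P -> f * g \in P.
Proof. by move=> [P0 _ PD] gP; rewrite -[_ * _]addr0 PD. Qed.

Lemma ideal_subr P f g : idealr_closed P -> f - g \in P -> (f \in P) = (g \in P).
Proof.
move=> [P0 _ PD] fg; apply/idP/idP => h.
  by rewrite -[g](subKr f) addrC -mulN1r PD.
by rewrite -[f](subrK g) -[f - g]mul1r PD.
Qed.

Lemma ideal_addr P f g : idealr_closed P -> g \in P -> (f + g \in P) = (f \in P).
Proof. by move=> Pid gP; apply: ideal_subr => //; rewrite addrC addKr. Qed.

Lemma prime_prod P (T : Type) (r : seq T) (Q : pred T) (f : T -> R) :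
  idealr_closed P -> prime_idealr_closed P ->
  (forall t, Q t -> f t \notin P) -> \prod_(t <- r | Q t) f t \notin P.
Proof.
move=> [_ P1 _] Pp h; elim/big_rec: _ => // t g Qt gP.
by apply/negP => /Pp; rewrite (negPf (h t Qt)) (negPf gP).
Qed.

(* If f_j lies in P_(j+1) but not in P_j, the least exponent of f_0 in a relation
   can be divided out modulo P_0, and modulo P_1 only the terms attaining it
   remain; iterating along the chain leaves a single coefficient. *)
Lemma chain_independent (P : nat -> {pred R}) (s N : nat) (f : nat -> R)
    (A : {set {ffun 'I_s -> 'I_N}}) (c : {ffun 'I_s -> 'I_N} -> R) :
  (forall j, (j <= s)%N -> idealr_closed (P j) /\ prime_idealr_closed (P j)) ->
  (forall j, (j < s)%N -> [/\ {subset P j <= P j.+1}, f j \in P j.+1 & f j \notin P j]) ->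
  A != set0 -> (forall e, e \in A -> c e \notin P s) ->
  \sum_(e in A) c e * \prod_(j < s) f j ^+ e j \notin P 0%N.
Proof.
move=> Pid Pf A0 cA.
(* Induction on [s - t]: the exponents in [B] agree in all coordinates below [t], and only the
   factors from [t] on are kept. *)
suff H k t : (t <= s)%N -> (s - t = k)%N -> forall B : {set {ffun 'I_s -> 'I_N}}, B != set0 -> B \subset A ->
    (forall e e', e \in B -> e' \in B -> forall j : 'I_s, (j < t)%N -> e j = e' j) ->
    \sum_(e in B) c e * \prod_(j < s | (t <= j)%N) f j ^+ e j \notin P t.
  by apply: (H s 0%N) => //; rewrite ?subn0.
elim: k t => [|k IH] t ts tk B B0 BA Beq.
  have {}ts : t = s by lia.
  have [e eB] := set0Pn _ B0.
  have -> : B = [set e].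
    apply/setP => e'; rewrite inE; apply/idP/eqP => [e'B|-> //].
    by apply/ffunP => j; apply: Beq => //; rewrite ts.
  rewrite big_set1 big1 ?mulr1 => [|j]; first by rewrite ts cA ?(subsetP BA).
  by rewrite ts leqNgt ltn_ord.
have {}ts : (t < s)%N by lia.
pose jt := Ordinal ts.
have [e0 e0B] := set0Pn _ B0.
case: (arg_minnP (fun e : {ffun 'I_s -> 'I_N} => e jt : nat) e0B) => e1 e1B e1min.
have {}e1B : e1 \in B := e1B.
pose B1 := [set e in B | e jt == e1 jt].
pose rest e := \prod_(j < s | (t < j)%N) f j ^+ (e : {ffun 'I_s -> 'I_N}) j.
have restE e : \prod_(j < s | (t <= j)%N) f j ^+ (e : {ffun 'I_s -> 'I_N}) j = f t ^+ e jt * rest e.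
  rewrite (bigD1 jt) //=; congr (_ * _); apply: eq_bigl => j.
  by rewrite -val_eqE /= ltn_neqAle eq_sym andbC.
have hB1 : \sum_(e in B1) c e * rest e \notin P t.+1.
  apply: IH => //; first by lia.
  - by apply/set0Pn; exists e1; rewrite inE e1B eqxx.
  - by apply: subset_trans BA; apply/subsetP => e; rewrite inE => /andP[].
  move=> e e'; rewrite !inE => /andP[eB /eqP ee] /andP[e'B /eqP ee'] j.
  rewrite ltnS leq_eqVlt => /orP[/eqP jE|]; last exact: Beq.
  have -> : j = jt by apply: val_inj; rewrite /= jE.
  by rewrite ee ee'.
have [Psub fP fnP] := Pf t ts.
have [idt prt] := Pid t (ltnW ts).
have [idt1 _] := Pid t.+1 ts.
apply: contraNN hB1 => hsum.
have eqsum : \sum_(e in B) c e * \prod_(j < s | (t <= j)%N) f j ^+ e j =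
    f t ^+ e1 jt * \sum_(e in B) c e * (f t ^+ (e jt - e1 jt) * rest e).
  rewrite mulr_sumr; apply: eq_bigr => e eB; rewrite restE.
  by rewrite -{1}(subnKC (e1min e eB)) exprD -!mulrA mulrCA.
rewrite eqsum in hsum; have /orP[fe|{}hsum] := prt _ _ hsum.
  have : \prod_(i < e1 jt) f t \notin P t by apply: prime_prod.
  by rewrite prodr_const card_ord fe.
have {hsum} := Psub _ hsum.
rewrite (bigID (fun e : {ffun 'I_s -> 'I_N} => e jt == e1 jt)) /=.
have -> : \sum_(e in B | e jt == e1 jt) c e * (f t ^+ (e jt - e1 jt) * rest e) =
          \sum_(e in B1) c e * rest e.
  by apply: eq_big => [e|e /andP[_ /eqP ->]]; rewrite ?inE // subnn mul1r.
rewrite ideal_addr //; apply: ideal_sum => // e /andP[eB ne]; apply: ideal_mull => //.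
rewrite mulrC; apply: ideal_mull => //.
have : (0 < e jt - e1 jt)%N by rewrite subn_gt0 ltn_neqAle e1min // andbT eq_sym; exact: ne.
by case: (_ - _)%N => // q _; rewrite exprSr ideal_mull.
Qed.

End PrimeChains.

(** * Algebraic dependence by counting monomials *)

Section KrullDimension.

Variables (K : fieldType) (n : nat).
Local Notation S := {mpoly K[n]}.
Implicit Types (x y : 'I_n) (F G H : {set 'I_n}) (D : {set {set 'I_n}}).
Implicit Types (b : 'X_{1..n}) (f g : S).

Definition exponents_in H (B : nat) f :=
  forall b, f@_b != 0 -> (forall x, (b x <= B)%N) /\ (forall x, x \notin H -> b x = 0%N).

Lemma exponents_inM H B1 B2 f g :
  exponents_in H B1 f -> exponents_in H B2 g -> exponents_in H (B1 + B2) (f * g).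
Proof.
move=> hf hg b; rewrite -mcoeff_msupp => /msuppM_le/allpairsP[[b1 b2] /= [b1f b2g ->]].
rewrite !mcoeff_msupp in b1f b2g; have [h1 h1'] := hf _ b1f; have [h2 h2'] := hg _ b2g.
by split=> x; rewrite mnmDE; [rewrite leq_add | move=> xH; rewrite h1' ?h2'].
Qed.

Lemma exponents_in1 H B : exponents_in H B 1.
Proof.
move=> b; rewrite mcoeff1; case: (b =P 0%MM) => [->|_]; last by rewrite eqxx.
by split=> x; rewrite mnm0E.
Qed.

Lemma exponents_inX H B e f : exponents_in H B f -> exponents_in H (e * B) (f ^+ e).
Proof.
move=> hf; elim: e => [|e IH]; first by rewrite expr0; apply: exponents_in1.
by rewrite exprS mulSn; apply: exponents_inM.
Qed.

Lemma exponents_in_prod H B s (f : 'I_s -> S) :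
  (forall j, exponents_in H B (f j)) -> exponents_in H (s * B) (\prod_j f j).
Proof.
elim: s f => [|s IH] f hf; first by rewrite big_ord0; apply: exponents_in1.
by rewrite big_ord_recl mulSn; apply: exponents_inM => //; apply: IH.
Qed.

Lemma exponents_in_le H B B' f : (B <= B')%N -> exponents_in H B f -> exponents_in H B' f.
Proof. by move=> BB' hf b /hf[h1 h2]; split=> // x; apply: leq_trans BB'. Qed.

(* With exponents below N there are N^s products of powers, more than the
   (s N M + 1)^|H| monomials available to them once s > |H| and N is large. *)
Lemma algebraic_dependence H s (f : 'I_s -> S) M :
  (#|H| < s)%N -> (forall j, exponents_in H M (f j)) ->
  exists N (c : {ffun 'I_s -> 'I_N} -> K), (exists e, c e != 0) /\
    \sum_e (c e)%:MP_[n] * \prod_j f j ^+ e j = 0.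
Proof.
move=> Hs hf.
(* Exponents stay below [B <= N * C], so the monomials number at most N^|H| * C^|H| < N^(|H| + 1) <=
   N^s. *)
pose C := (s * M).+1; pose N := (C ^ #|H|).+1; pose B := (s * (N * M)).+1.
pose T := [set t in pffun_on (ord0 : 'I_B) (mem H) (mem [set: 'I_B])].
pose E : finType := {ffun 'I_s -> 'I_N}.
have cT : (#|T| <= (N * C) ^ #|H|)%N.
  rewrite cardsE card_pffun_on cardsT card_ord.
  have BNC : (B <= N * C)%N.
    by rewrite /B /C mulnS mulnCA -addn1 addnC leq_add2r.
  by case: #|H| => // h; rewrite leq_exp2r.
pose mT (t : {ffun 'I_n -> 'I_B}) : 'X_{1..n} := [multinom (t x : nat) | x < n].
pose m (e : E) : S := \prod_j f j ^+ e j.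
pose A : 'M[K]_(#|E|, #|T|) := \matrix_(r, t) (m (enum_val r))@_(mT (enum_val t)).
have TE : (#|T| < #|E|)%N.
  apply: leq_ltn_trans cT _; rewrite card_ffun !card_ord expnMn.
  apply: (@leq_trans (N ^ #|H| * N)%N); last by rewrite -expnSr leq_pexp2l.
  by rewrite ltn_pmul2l ?expn_gt0.
have [z zA zN0] : exists2 z : 'rV[K]_(#|E|), z *m A = 0 & z != 0.
  have : kermx A != 0.
    rewrite -mxrank_eq0 mxrank_ker -lt0n subn_gt0.
    by apply: leq_ltn_trans (rank_leq_col A) _.
  by case/rowV0Pn => z /sub_kermxP; exists z.
exists N, (fun e => z 0 (enum_rank e)); split.
  have : ~~ [forall r, z 0 r == 0].
    by apply: contraNN zN0 => /forallP h; apply/eqP/rowP => r; rewrite mxE; apply/eqP.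
  by case/forallPn => r zr; exists (enum_val r); rewrite enum_valK.
apply/mpolyP => b; rewrite mcoeff0 raddf_sum /=; under eq_bigr do rewrite mul_mpolyC mcoeffZ.
have mE e : exponents_in H (s * (N * M)) (m e).
  apply: exponents_in_prod => j; apply: (@exponents_in_le _ (e j * M)); last exact: exponents_inX.
  by rewrite leq_mul2r ltnW ?orbT // ltn_ord.
case: (boolP [forall x, (b x < B)%N && ((x \notin H) ==> (b x == 0%N))]) => bB; last first.
  rewrite big1 // => e _; have [->|/mE[h1 h2]] := eqVneq (m e)@_b 0; first by rewrite mulr0.
  case/forallPn: bB => x; rewrite negb_and -leqNgt ltnNge h1 negb_imply /= => /andP[xH].
  by rewrite h2 ?eqxx.
have bltB x : (b x < B)%N by have /andP[] := forallP bB x.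
pose t : {ffun 'I_n -> 'I_B} := [ffun x => Ordinal (bltB x)].
have tT : t \in T.
  rewrite inE; apply/pffun_onP; split; last by move=> u _; rewrite !inE.
  apply/supportP => x xH; rewrite ffunE; apply: val_inj => /=.
  by have /andP[_ /implyP/(_ xH)/eqP] := forallP bB x.
have mt : mT t = b by apply/mnmP => x; rewrite mnmE ffunE.
have := congr1 (fun v : 'rV[K]_(#|T|) => v 0 (enum_rank_in tT t)) zA.
rewrite !mxE => h; rewrite -[RHS]h (reindex (@enum_val E predT)) /=; last first.
  by exists enum_rank => e _; rewrite ?enum_valK ?enum_rankK.
by apply: eq_bigr => r _; rewrite enum_valK mxE enum_rankK_in // mt.
Qed.

End KrullDimension.

(** * Krull dimension of symbolic powers *)

Section KrullDimensionSymbolic.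

Variables (K : fieldType) (n : nat) (D : {set {set 'I_n}}) (m : nat).
Local Notation S := {mpoly K[n]}.
Implicit Types (x y : 'I_n) (F G H : {set 'I_n}).
Implicit Types (b : 'X_{1..n}) (f g : S).

(** Otherwise every facet has a variable outside it that is not in [P]. The product over all facets
    of the m-th powers of such variables lies in the symbolic power but, [P] being prime, not in
    [P]. *)
Lemma prime_contains_facet_ideal (P : {pred S}) :
  idealr_closed P -> prime_idealr_closed P ->
  (forall f, symbolic_power D m f -> f \in P) ->
  exists2 H, H \in facets D & forall x, x \notin H -> ('X_x : S) \in P.
Proof.
move=> Pid Pp IP.
case: (boolP [exists H in facets D, [forall x, (x \notin H) ==> (('X_x : S) \in P)]]).
  by move=> /existsP[H /andP[Hf /forallP h]]; exists H => // x; apply: implyP (h x).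
rewrite negb_exists => /forallP noH.
pose fac H : S := \prod_(x | (x \notin H) && (('X_x : S) \notin P)) 'X_x ^+ m.
have Xm x : ('X_x : S) \notin P -> ('X_x : S) ^+ m \notin P.
  by move=> xP; rewrite -[m]card_ord -prodr_const; apply: prime_prod.
have facP : \prod_(H in facets D) fac H \notin P.
  by apply: prime_prod => // H _; apply: prime_prod => // x /andP[_]; apply: Xm.
case/negP: facP; apply: IP; apply/symbolic_powerP => H Hf.
rewrite (bigD1 H) //= mulrC; apply: order_ge_mull.
have := noH H; rewrite Hf /= => /forallPn[x]; rewrite negb_imply => hx.
rewrite /fac (bigD1 x) //= mulrC; apply: order_ge_mull => b.
rewrite mpolyXn mcoeffX; case: (_ =P b) => [<- _|_]; last by rewrite eqxx.
have /andP[xH _] := hx.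
by rewrite (bigD1 x) ?inE //= mulmnE mnm1E eqxx mul1n leq_addr.
Qed.

Let const_notin (P : {pred S}) (c : K) : idealr_closed P -> c != 0 -> c%:MP_[n] \notin P.
Proof.
move=> Pid c0; have [_ P1 _] := Pid; apply: contraNN P1 => cP.
have -> : 1 = (c^-1)%:MP_[n] * c%:MP_[n] by rewrite -mpolyCM mulVf ?mpolyC1.
exact: ideal_mull.
Qed.

(* Modulo the variables outside H. *)
Let trunc H f : S := \sum_(b <- msupp f | [forall x, (x \notin H) ==> (b x == 0%N)]) f@_b *: 'X_[b].

Let trunc_ideal (P : {pred S}) H f : idealr_closed P ->
  (forall x, x \notin H -> ('X_x : S) \in P) -> (f \in P) = (trunc H f \in P).
Proof.
move=> Pid HP; rewrite [in LHS](mpolyE f) (bigID (fun b => [forall x, (x \notin H) ==> (b x == 0%N)])) /=.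
apply: ideal_addr => //; apply: ideal_sum => // b /forallPn[x]; rewrite negb_imply => /andP[xH bx].
have Ub : (U_(x) <= b)%MM by rewrite lep1mP.
by rewrite -(submK Ub) mpolyXD scalerAl; apply: ideal_mull => //; apply: HP.
Qed.

Let trunc_exponents H f : exponents_in H (msize f) (trunc H f).
Proof.
move=> b; rewrite /trunc raddf_sum /= => nz.
have /hasP[b' bf /andP[hb' bb']] : has (fun b' => [forall x, (x \notin H) ==> (b' x == 0%N)] && (b' == b)) (msupp f).
  apply: contraNT nz => /hasPn h; rewrite big_seq_cond big1 // => b' /andP[b'f hb'].
  by have := h b' b'f; rewrite hb' /= mcoeffZ mcoeffX => /negPf ->; rewrite mulr0.
rewrite -(eqP bb'); split=> x; last by move=> xH; have /implyP/(_ xH)/eqP := forallP hb' x.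
apply: leq_trans (ltnW (msize_mdeg_lt bf)); rewrite mdegE (bigD1 x) //=; exact: leq_addr.
Qed.

(** Modulo [P 0] the variables outside some facet [H] vanish. More than [#|H|] steps in the chain
    would yield [#|H|.+1] polynomials in the variables of [H], dependent by counting but independent
    by [chain_independent]. *)
Lemma lt_krull_dim_symbolic_power_le i : lt_krull_dim i (@symbolic_power K n D m) ->
  (i < \max_(F in D) #|F|)%N.
Proof.
move=> [P [Pid Pinc]].
have [id0 pr0 IP0] := Pid 0%N isT.
have [H Hf HP] := prime_contains_facet_ideal id0 pr0 IP0.
have /facetsP[HD _] := Hf.
apply: leq_trans (leq_card_max HD); rewrite ltnNge; apply/negP => Hi.
have sub0 j : (j <= i.+1)%N -> {subset P 0%N <= P j}.
  elim: j => [|j IH] ji x // x0; have [sj _] := Pinc j ji.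
  by apply: sj; apply: IH => //; apply: ltnW.
have HPj j x : (j <= i.+1)%N -> x \notin H -> ('X_x : S) \in P j.
  by move=> ji xH; apply: (sub0 j ji); apply: HP.
pose s := #|H|.+1.
have si j : (j < s)%N -> (j < i.+1)%N by move=> js; apply: leq_trans js _.
have /fin_all_exists[f0 f0P] (j : 'I_s) : exists f, f \in P j.+1 /\ f \notin P j.
  by have [_ [f f1 f2]] := Pinc j (si j (ltn_ord j)); exists f.
pose ft (j : 'I_s) := trunc H (f0 j).
pose M := (\max_j msize (f0 j))%N.
have ftM j : exponents_in H M (ft j).
  apply: (@exponents_in_le _ _ _ (msize (f0 j))); last exact: trunc_exponents.
  exact: (leq_bigmax (F := fun j => msize (f0 j)) j).
have [N [c [[e0 ce0] crel]]] := algebraic_dependence (ltnSn #|H|) ftM.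
pose f j := if insub j is Some t then ft t else 0.
have fE (j : 'I_s) : f j = ft j by rewrite /f valK.
have rel : \sum_(e in [set e | c e != 0]) (c e)%:MP_[n] * \prod_(j < s) f j ^+ e j = 0.
  rewrite -[RHS]crel [in RHS](bigID (fun e => c e != 0)) /= [X in _ = _ + X]big1 ?addr0.
    apply: eq_big => [e|e _]; first by rewrite inE.
    by congr (_ * _); apply: eq_bigr => j _; rewrite fE.
  by move=> e; rewrite negbK => /eqP ->; rewrite mpolyC0 mul0r.
suff: \sum_(e in [set e | c e != 0]) (c e)%:MP_[n] * \prod_(j < s) f j ^+ e j \notin P 0%N.
  by rewrite rel; have [-> _ _] := id0.
apply: chain_independent.
- by move=> j js; have [|idj prj _] := Pid j; first exact: leq_trans js _.
- move=> j js; have ji := si j js; have [sj _] := Pinc j ji.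
  have [idj _ _] := Pid j (ltnW ji); have [idj1 _ _] := Pid j.+1 ji.
  have [h1 h2] := f0P (Ordinal js); split=> //; rewrite (fE (Ordinal js)).
    by rewrite -trunc_ideal // => x; apply: HPj.
  by rewrite -trunc_ideal // => x; apply: HPj; apply: ltnW.
- by apply/set0Pn; exists e0; rewrite inE.
- by move=> e; rewrite inE => ce; apply: const_notin => //; have [] := Pid s Hi.
Qed.

Let restrict_vars F : n.-tuple S := [tuple if x \in F then 'X_x else 0 | x < n].
(** The prime generated by the variables outside [F], taken as the kernel of a substitution:
    membership is then decidable, and primality holds because the target is a domain. *)
Let coord_prime F : {pred S} := [pred f : S | comp_mpoly (restrict_vars F) f == 0].

Let coord_primeX F x : (('X_x : S) \in coord_prime F) = (x \notin F).
Proof.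
rewrite inE comp_mpolyXU -tnth_nth tnth_mktuple; case: (x \in F); rewrite ?eqxx //.
apply/eqP => /(congr1 (mcoeff U_(x)%MM)) /eqP.
by rewrite mcoeffX mcoeff0 eqxx oner_eq0.
Qed.

Let comp_restrict_vars F F' f : F' \subset F ->
  comp_mpoly (restrict_vars F') (comp_mpoly (restrict_vars F) f) =
  comp_mpoly (restrict_vars F') f.
Proof.
move=> F'F; rewrite !(comp_mpolyEX f) raddf_sum; apply: eq_bigr => b _ /=.
rewrite comp_mpolyZ !comp_mpolyX rmorph_prod; congr (_ *: _); apply: eq_bigr => x _ /=.
rewrite rmorphXn /= !tnth_mktuple; congr (_ ^+ _); case: (boolP (x \in F)) => xF.
  by rewrite comp_mpolyXU -tnth_nth tnth_mktuple.
by rewrite comp_mpoly0 ifN // (contraNN (subsetP F'F x)).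
Qed.

Let coord_prime_sub F F' : F' \subset F -> {subset coord_prime F <= coord_prime F'}.
Proof.
move=> F'F f /eqP fF; apply/eqP.
by rewrite -(comp_restrict_vars f F'F) fF comp_mpoly0.
Qed.

(** The chain starts at the prime of a facet [H] with more than [i] vertices and sends one further
    vertex of [H] to 0 at each step. *)
Lemma lt_krull_dim_symbolic_power i : (0 < m)%N -> D != set0 ->
  (i < \max_(F in D) #|F|)%N -> lt_krull_dim i (@symbolic_power K n D m).
Proof.
move=> m0 D0 iD.
have [H Hf Hi] : exists2 H, H \in facets D & (i < #|H|)%N.
  have [F FD Fmax] : {F | F \in D & (\max_(F in D) #|F| = #|F|)%N}.
    by apply: (eq_bigmax_cond (fun F : {set 'I_n} => #|F|)); rewrite card_gt0.
  have [H Hf FH] := subset_facet FD; exists H => //.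
  by apply: leq_trans iD _; rewrite Fmax subset_leq_card.
pose h j : {set 'I_n} := [set x in drop j (enum H)].
exists (fun j => coord_prime (h j)); split=> j ji.
  split.
  - split; first by rewrite inE comp_mpoly0.
      by rewrite inE comp_mpoly1 oner_eq0.
    by move=> a u v; rewrite !inE rmorphD rmorphM /= => /eqP -> /eqP ->; rewrite mulr0 addr0.
  - by move=> u v; rewrite !inE rmorphM /= mulf_eq0.
  move=> f /symbolic_powerP fI; rewrite inE (mpolyE f) raddf_sum big_seq big1 //= => b bf.
  rewrite comp_mpolyZ comp_mpolyX.
  (* As [m > 0], each monomial of [f] involves a variable outside [H], which is sent to 0. *)
  have [x xH bx] : exists2 x, x \notin H & (0 < b x)%N.
    have := fI H Hf b; rewrite -mcoeff_msupp bf => /(_ isT).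
    case: (pickP [pred x | (x \in ~: H) && (0 < b x)%N]) => [x /andP[xH bx] _|hx].
      by exists x => //; rewrite inE in xH.
    rewrite big1 => [|x xH]; first by rewrite leqNgt m0.
    by have := hx x; rewrite /= xH /= lt0n => /negbFE/eqP.
  have xh : x \notin h j.
    by apply: contraNN xH; rewrite inE => /mem_drop; rewrite mem_enum.
  by rewrite (bigD1 x) //= tnth_mktuple (negPf xh) expr0n eqn0Ngt bx mul0r scaler0.
have [x0 _] : exists x, x \in H by apply/card_gt0P; apply: leq_ltn_trans Hi.
have jH : (j < size (enum H))%N by rewrite -cardE; apply: leq_trans Hi.
have hE : drop j (enum H) = nth x0 (enum H) j :: drop j.+1 (enum H) by rewrite -drop_nth.
have hsub : h j.+1 \subset h j.
  by apply/subsetP => x; rewrite !inE hE inE => ->; rewrite orbT.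
split; first exact: coord_prime_sub hsub.
exists 'X_(nth x0 (enum H) j); rewrite coord_primeX in_set; last by rewrite hE inE eqxx.
by have := drop_uniq j (enum_uniq (mem H)); rewrite hE => /andP[].
Qed.

End KrullDimensionSymbolic.

Theorem theorem3p7 (K : fieldType) (n : nat) (D : {set {set 'I_n}}) :
  simplicial_complex [set: 'I_n] D ->
  (2 <= dim_complex D)%R ->
  ((forall m : nat, (1 <= m)%N ->
      generalized_Cohen_Macaulay (@symbolic_power K n D m)) <->
   (exists2 m : nat, (3 <= m)%N &
      generalized_Cohen_Macaulay (@symbolic_power K n D m))) /\
  ((exists2 m : nat, (3 <= m)%N &
      generalized_Cohen_Macaulay (@symbolic_power K n D m)) <->
   disjoint_union_of_matroids D).
Proof.
move=> Dc Dd.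
have d3 : (2 < \max_(F in D) #|F|)%N by move: Dd; rewrite /dim_complex; clear; lia.
have D0 : D != set0 by apply: contraTneq d3 => ->; rewrite big_set0.
(* The lower bound on the Krull dimension provides finiteness in every degree [p < d]. *)
have gCM_matroids m : (3 <= m)%N -> generalized_Cohen_Macaulay (@symbolic_power K n D m) ->
    disjoint_union_of_matroids D.
  move=> m3 gCM; apply: (@disjoint_matroids_of_acyclic K n D m) => // G w p G0 pd.
  apply: acyclic_of_fin_dim G0; apply: gCM.
  by apply: lt_krull_dim_symbolic_power => //; apply: leq_trans m3.
(* The upper bound on the Krull dimension confines the degrees to those where matroids give
   vanishing. *)
have matroids_gCM m : disjoint_union_of_matroids D ->
    generalized_Cohen_Macaulay (@symbolic_power K n D m).
  move=> Dm i /lt_krull_dim_symbolic_power_le id.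
  by apply: fin_dim_of_acyclic => G w G0; apply: acyclic_disjoint_matroids.
split; split.
- by move=> h; exists 3 => //; apply: h.
- by move=> [m m3 /(gCM_matroids m m3) Dm] m' _; apply: matroids_gCM.
- by move=> [m m3]; apply: gCM_matroids.
- by move=> Dm; exists 3 => //; apply: matroids_gCM.
Qed.
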